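(* There exist a Hilbert lattice $H$, a real self-adjoint $C_0$-semigroup $(e^{tA})_{t\ge 0}$ on $H$ with generator $A$, and a strictly positive vector $u\in H$ such that the following assertions hold: (i) The generator $A$ has compact resolvent. (ii) The semigroup $(e^{tA})_{t\ge 0}$ is individually eventually strongly positive with respect to $u$. (iii) The operator $e^{nA}$ is not positive for each sufficiently large $n\in\mathbb{N}$. In particular, $(e^{tA})_{t\ge0}$ is neither uniformly eventually positive nor uniformly eventually positive with respect to $u\otimes u$.
   Context: A Hilbert lattice is a Banach lattice whose norm is induced by an inner product (e.g. $L^2(\Omega,\mu)$ or $\ell^2(\mathbb{Z})$ with the pointwise order). In the complex case $H$ is the complexification of a real Hilbert lattice, and an operator or semigroup is called real if it maps the real part of $H$ (intersected with the domain) into the real part. A vector $f$ satisfies $f>0$ if $f\ge 0$ and $f\ne 0$. A vector $u\ge 0$ is strictly positive if $\langle u,f\rangle>0$ for all $0<f\in H$; in $\ell^2$ this means that all coordinates of $u$ are $>0$. A bounded operator $T$ on $H$ is positive ($T\ge 0$) if $Tf\ge0$ for all $0\le f\in H$, and $T\ge S$ means $T-S\ge 0$. A semigroup is self-adjoint if each of its operators (equivalently, its generator) is self-adjoint. For $0<u\in H$ write $f\succeq u$ if $f\ge cu$ for some $c>0$. The semigroup is individually eventually strongly positive with respect to $u$ if for each $0<f\in H$ there exists $t_f\ge0$ such that $e^{tA}f\succeq u$ for all $t\ge t_f$ (the constant $c$ may depend on $f$ and $t$). It is uniformly eventually positive if there is $t_0\ge 0$ with $e^{tA}\ge 0$ for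 all $t\ge t_0$. It is uniformly eventually positive with respect to $u\otimes u$ if there exist $t_0\ge0$ and $c>0$ such that $e^{tA}\ge c\,(u\otimes u)$ for all $t\ge t_0$, where $(v\otimes w)x:= v\langle w,x\rangle$. *)

(* Defs.v *)
From HB Require Import structures.
From mathcomp Require Import all_boot all_order all_algebra.
From mathcomp Require Import all_classical all_reals all_analysis.
From mathcomp Require Import complex.
From mathcomp Require Import ring lra.

Set Implicit Arguments.
Unset Strict Implicit.
Unset Printing Implicit Defensive.

Import Order.TTheory GRing.Theory Num.Theory.
Import numFieldNormedType.Exports.

Local Open Scope classical_set_scope.
Local Open Scope ring_scope.
Local Open Scope complex_scope.

(* The order is a field of its own, rather than an [Order.Lattice] structure,
   because the library has no common substructure of ordered and normed types
   below [numDomainType], so that Hierarchy Builder rejects the join. *)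
HB.mixin Record isVectorLattice (R : realType) E & GRing.Lmodule R E := {
  vle : E -> E -> Prop ;
  vsup : E -> E -> E ;
  vinf : E -> E -> E ;
  vle_refl : forall x, vle x x ;
  vle_anti : forall x y, vle x y -> vle y x -> x = y ;
  vle_trans : forall x y z, vle x y -> vle y z -> vle x z ;
  vleD2r : forall z x y, vle x y -> vle (x + z) (y + z) ;
  vle_scale : forall (a : R) x y, 0 <= a -> vle x y -> vle (a *: x) (a *: y) ;
  vsup_le : forall x y z, vle (vsup x y) z <-> vle x z /\ vle y z ;
  vle_inf : forall x y z, vle z (vinf x y) <-> vle z x /\ vle z y
}.

#[short(type="vectorLatticeType")]
HB.structure Definition VectorLattice (R : realType) :=
  {E of GRing.Lmodule R E & isVectorLattice R E}.

Definition vabs (R : realType) (E : vectorLatticeType R) (x : E) : E :=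
  vsup x (- x).

HB.mixin Record hasLatticeNorm (R : realType) E
    & CompleteNormedModule R E & VectorLattice R E := {
  vle_norm : forall x y : E, vle (vabs x) (vabs y) -> `|x| <= `|y|
}.

#[short(type="banachLatticeType")]
HB.structure Definition BanachLattice (R : realType) :=
  {E of CompleteNormedModule R E & VectorLattice R E & hasLatticeNorm R E}.

HB.mixin Record hasInnerProductNorm (R : realType) E & BanachLattice R E := {
  dotp : {dot E for (@idfun R)} ;
  hnormE : forall x : E, `|x| ^+ 2 = dotp x x
}.

#[short(type="hilbertLatticeType")]
HB.structure Definition HilbertLattice (R : realType) :=
  {E of BanachLattice R E & hasInnerProductNorm R E}.

(* The pair (a, b) stands for a + i b. *)
Definition complexification (R : realType) (E : hilbertLatticeType R) : Type :=
  (E * E)%type.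

Section complexification_theory.
Context (R : realType) (E : hilbertLatticeType R).
Local Notation H := (complexification E).

HB.instance Definition _ := GRing.Zmodule.copy H (E * E)%type.

(* (p + i q)(a + i b) = (p a - q b) + i (p b + q a) *)
Definition cscale (z : R[i]) (f : H) : H :=
  (complex.Re z *: f.1 - complex.Im z *: f.2,
   complex.Re z *: f.2 + complex.Im z *: f.1).

Lemma cscaleA z w f : cscale z (cscale w f) = cscale (z * w) f.
Proof.
case: z w f => [a b] [c d] [x y]; rewrite /cscale /=; congr pair.
  rewrite !(scalerBr, scalerDr, scalerBl, scalerDl, scalerA) !opprD !addrA.
  by rewrite [LHS](ACl (1*4*2*3))%AC.
rewrite !(scalerBr, scalerDr, scalerBl, scalerDl, scalerA) !addrA.
by rewrite [LHS](ACl (1*4*2*3))%AC.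
Qed.

Lemma cscale1 : left_id 1 cscale.
Proof. by case=> x y; rewrite /cscale /= !scale1r !scale0r subr0 addr0. Qed.

Lemma cscaleDr : right_distributive cscale +%R.
Proof.
move=> [a b] [x y] [x' y']; rewrite /cscale /=; congr pair;
  by rewrite /= !scalerDr ?opprD addrACA.
Qed.

Lemma cscaleDl f : {morph cscale^~ f : z w / z + w}.
Proof.
case: f => x y [a b] [c d]; rewrite /cscale /=; congr pair;
  by rewrite /= !scalerDl ?opprD addrACA.
Qed.

HB.instance Definition _ := GRing.Zmodule_isLmodule.Build R[i] H
  cscaleA cscale1 cscaleDr cscaleDl.

(* Linear in the first argument, as all sesquilinear forms of the library. *)
Definition cdot (f g : H) : R[i] :=
  (dotp f.1 g.1 + dotp f.2 g.2) +i* (dotp f.2 g.1 - dotp f.1 g.2).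

Lemma cdot_bilinear : bilinear_for
  (GRing.Scale.Law.clone _ _ ( *%R ) _)
  (GRing.Scale.Law.clone _ _ (Num.conj \; *%R) _) cdot.
Proof.
split=> [[x' y'] [a b] [x y] [z w]|[x' y'] [a b] [x y] [z w]].
  rewrite /cdot /=; apply/eqP; rewrite eq_complex /=.
  rewrite !(linearDl, linearBl, linearNl, linearZl_LR) /=.
  by apply/andP; split; apply/eqP; ring.
rewrite /cdot /=; apply/eqP; rewrite eq_complex /=.
rewrite !(linearDr, linearBr, linearNr, linearZr_LR) /=.
by apply/andP; split; apply/eqP; ring.
Qed.

HB.instance Definition _ := bilinear_isBilinear.Build R[i] H H R[i]
  (GRing.Scale.Law.clone _ _ ( *%R ) _)
  (GRing.Scale.Law.clone _ _ (Num.conj \; *%R) _) cdot cdot_bilinear.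

Lemma dotpC (x y : E) : dotp x y = dotp y x.
Proof. by rewrite hermC expr0 mul1r. Qed.

Lemma cdotC f g : cdot f g = (-1) ^+ false * Num.conj (cdot g f).
Proof.
rewrite expr0 mul1r /cdot; apply/eqP; rewrite eq_complex /=.
rewrite (dotpC g.1) (dotpC g.2) (dotpC g.2) (dotpC g.1).
by apply/andP; split; apply/eqP; ring.
Qed.

HB.instance Definition _ :=
  isHermitianSesquilinear.Build R[i] H false Num.conj cdot cdotC.

Definition cnorm (f : H) : R[i] :=
  (Num.sqrt (`|f.1| ^+ 2 + `|f.2| ^+ 2))%:C.

Lemma cnormE f : cnorm f = `| `|f.1| +i* `|f.2| |.
Proof. by rewrite normc_def. Qed.

Lemma ler_cnormD f g : cnorm (f + g) <= cnorm f + cnorm g.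
Proof.
rewrite [leRHS](_ : _ = `| `|f.1| +i* `|f.2| | + `| `|g.1| +i* `|g.2| |).
  apply: le_trans (ler_normD _ _); rewrite normc_def /cnorm lecR ler_sqrt.
    by rewrite lerD// lerXn2r// ?nnegrE ?addr_ge0// ler_normD.
  by rewrite addr_ge0// sqr_ge0.
by rewrite !cnormE.
Qed.

Lemma cnormZ z f : cnorm (z *: f) = `|z| * cnorm f.
Proof.
case: z f => [a b] [x y]; rewrite normc_def /cnorm -rmorphM/= -sqrtrM.
  congr ((Num.sqrt _)%:C); rewrite !hnormE.
  rewrite !(linearDl, linearBl, linearNl, linearZl_LR)/=.
  rewrite !(linearDr, linearBr, linearNr, linearZr_LR)/= (dotpC y x).
  by ring.
by rewrite addr_ge0// sqr_ge0.
Qed.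

Lemma cnorm0_eq0 f : cnorm f = 0 -> f = 0.
Proof.
case: f => x y; rewrite cnormE => /normr0_eq0 /eqP; rewrite eq_complex/=.
by rewrite !normr_eq0 => /andP[/eqP -> /eqP ->].
Qed.

HB.instance Definition _ := Lmodule_isNormed.Build R[i] H
  ler_cnormD cnormZ cnorm0_eq0.

Lemma cnorm_dot (f : H) : `|f| ^+ 2 = cdot f f.
Proof.
rewrite [`|f|]/(cnorm f) /cnorm -rmorphXn/= sqr_sqrtr ?addr_ge0 ?sqr_ge0//.
by rewrite /cdot !hnormE dotpC subrr.
Qed.

Lemma cdot_gt0 f : f != 0 -> 0 < cdot f f.
Proof. by move=> f0; rewrite -cnorm_dot exprn_gt0 ?normr_gt0. Qed.

HB.instance Definition _ := isDotProduct.Build R[i] H cdot cdot_gt0.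

Lemma ler_norm_fst (f : H) : `|f.1|%:C <= `|f|.
Proof.
rewrite [`|f|]/(cnorm f) lecR -[leLHS]normr_id -sqrtr_sqr.
by rewrite ler_sqrt ?addr_ge0 ?sqr_ge0// lerDl sqr_ge0.
Qed.

Lemma ler_norm_snd (f : H) : `|f.2|%:C <= `|f|.
Proof.
rewrite [`|f|]/(cnorm f) lecR -[leLHS]normr_id -sqrtr_sqr.
by rewrite ler_sqrt ?addr_ge0 ?sqr_ge0// lerDr sqr_ge0.
Qed.

Lemma ler_cnorm_add (f : H) : `|f| <= (`|f.1| + `|f.2|)%:C.
Proof.
rewrite [`|f|]/(cnorm f) lecR -[leRHS]ger0_norm ?addr_ge0// -sqrtr_sqr.
by rewrite ler_sqrt ?sqr_ge0// sqrrD lerD2r lerDl mulrn_wge0// mulr_ge0.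
Qed.

Lemma complexification_complete (F : set_system H) :
  ProperFilter F -> cauchy F -> cvg F.
Proof.
move=> FF /cauchy_ballP Fc.
have proj_cvg (p : H -> E) : (forall f g, p f - p g = p (f - g)) ->
    (forall f, `|p f|%:C <= `|f|) -> cvg (p @ F).
  move=> pB ple; apply/cauchy_cvgP/cauchy_ballP => e e0.
  have /Fc[[P Q] [/= FP FQ] PQ] : 0 < e%:C by rewrite ltcR.
  exists (p @` P, p @` Q).
    by split; [apply: filterS FP|apply: filterS FQ] => f; exists f.
  case=> _ _ [/= [f Pf <-] [g Qg <-]]; have /= := PQ (f, g) (conj Pf Qg).
  by rewrite -!ball_normE /= pB -ltcR; apply: le_lt_trans.
have /cvg_ex[/= a Fa] := proj_cvg fst (fun _ _ => erefl) ler_norm_fst.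
have /cvg_ex[/= b Fb] := proj_cvg snd (fun _ _ => erefl) ler_norm_snd.
apply/cvg_ex; exists ((a, b) : H); apply/cvgrPdist_lt => -[e e'].
rewrite ltcE /= => /andP[/eqP -> e0].
have e2 : 0 < e / 2 by rewrite divr_gt0.
move/cvgrPdist_lt: Fa => /(_ (e / 2) e2) Fa.
move/cvgrPdist_lt: Fb => /(_ (e / 2) e2) Fb.
near=> f; apply: le_lt_trans (ler_cnorm_add _) _; rewrite ltcR [ltRHS]splitr.
by rewrite ltrD//=; near: f.
Unshelve. all: by end_near. Qed.

HB.instance Definition _ :=
  Uniform_isComplete.Build H complexification_complete.

End complexification_theory.

Section semigroup.
Context (R : realType) (V : completeNormedModType R[i]).
Implicit Types (T : R -> V -> V) (B : V -> V).

(* T t is the operator e^{tA}; its values at t < 0 are irrelevant. *)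
Record C0_semigroup T : Prop := {
  sg_linear : forall t, 0 <= t -> linear (T t) ;
  sg_bounded : forall t, 0 <= t -> continuous (T t) ;
  sg0 : forall x, T 0 x = x ;
  sgD : forall s t x, 0 <= s -> 0 <= t -> T (s + t) x = T s (T t x) ;
  sg_strongly_continuous : forall x,
    {within [set t | 0 <= t], continuous (fun t => T t x)}
}.

(* Only the values of [pop_val] on [pop_dom] are meaningful. *)
Record partial_operator := PartialOperator {
  pop_dom : set V ;
  pop_val : V -> V
}.

Definition generator T : partial_operator :=
  let quotient x (h : R) := (h^-1)%:C *: (T h x - x) in
  {| pop_dom := [set x | cvg (quotient x h @[h --> 0^'+])] ;
     pop_val := fun x => lim (quotient x h @[h --> 0^'+]) |}.

(* B = (z - A)^{-1}, an everywhere defined bounded operator *)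
Record is_resolvent (A : partial_operator) (z : R[i]) B : Prop := {
  res_linear : linear B ;
  res_bounded : continuous B ;
  res_dom : forall y, pop_dom A (B y) ;
  res_right : forall y, z *: B y - pop_val A (B y) = y ;
  res_left : forall x, pop_dom A x -> B (z *: x - pop_val A x) = x
}.

Definition compact_operator B : Prop :=
  linear B /\ precompact (B @` [set x | `|x| <= 1]).

Definition compact_resolvent (A : partial_operator) : Prop :=
  (exists z B, is_resolvent A z B) /\
  (forall z B, is_resolvent A z B -> compact_operator B).

End semigroup.

Section positivity.
Context (R : realType) (E : hilbertLatticeType R).
Local Notation H := (complexification E).
Implicit Types (f g u v w : H) (S B : H -> H) (T : R -> H -> H).

Definition real_part : set H := [set f | f.2 = 0].

(* f <= g iff g - f lies in the positive cone of the real part. *)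
Definition cle f g : Prop := vle f.1 g.1 /\ f.2 = g.2.

Definition cpos f : Prop := cle 0 f /\ f <> 0.

Definition strictly_positive u : Prop :=
  cle 0 u /\ forall f, cpos f -> 0 < cdot u f.

Definition real_semigroup T : Prop :=
  forall t, 0 <= t -> T t @` real_part `<=` real_part.

Definition self_adjoint_semigroup T : Prop :=
  forall t, 0 <= t -> forall f g, cdot (T t f) g = cdot f (T t g).

Definition positive_operator B : Prop := forall f, cle 0 f -> cle 0 (B f).

Definition operator_le S B : Prop := positive_operator (fun f => B f - S f).

(* x |-> v <w, x> with <w, x> linear in x *)
Definition tensor v w : H -> H := fun x => cdot x w *: v.

Definition dominates f u : Prop := exists2 c : R, 0 < c & cle (c%:C *: u) f.

Definition individually_eventually_strongly_positive T u : Prop :=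
  forall f, cpos f -> exists2 t_f : R, 0 <= t_f &
    forall t, t_f <= t -> dominates (T t f) u.

Definition uniformly_eventually_positive T : Prop :=
  exists2 t0 : R, 0 <= t0 & forall t, t0 <= t -> positive_operator (T t).

Definition uniformly_eventually_positive_wrt T v w : Prop :=
  exists t0 c : R, [/\ 0 <= t0, 0 < c &
    forall t, t0 <= t -> operator_le (fun x => c%:C *: tensor v w x) (T t)].

End positivity.

(* Main.v *)
(* The coordinates of l2(N) are grouped into pairs [2k, 2k+1]. Start from the
   diagonal operator whose eigenvalue on the [k]-th pair is [-2^k] for the
   antisymmetric vector (1, -1), and the slightly smaller [-(2^k + w_k)] (or 0
   if k = 0) for the symmetric vector (1, 1), with [w_k = exp(-5 k 2^k)]. Its
   semigroup has a negative off-diagonal entry on each pair, of size about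
   [t w_k exp(-t 2^k) / 2]. Conjugating with the reflection along the vector [w]
   that takes the value [w_k] on both coordinates of the [k]-th pair preserves
   symmetry on the pairs and adds, for large [t], a kernel comparable to
   [w_i w_j].
   For fixed [f > 0] the positive term is about [<f, w> w], while the negative one
   is at most [t exp(-t) |f| w], so that positivity wins for [t] large depending
   on the ratio of [|f|] to [<f, w>]. On the [n]-th pair at time [n], however, the
   negative entry, about [w_n exp(-n 2^n)], beats the positive one, which is
   about [w_n ^ 2]. *)
Require Import Defs.
From HB Require Import structures.
From mathcomp Require Import all_boot all_order all_algebra.
From mathcomp Require Import all_classical all_reals all_analysis.
From mathcomp Require Import complex.
From mathcomp Require Import ring lra.

Set Implicit Arguments.
Unset Strict Implicit.
Unset Printing Implicit Defensive.

Import Order.TTheory GRing.Theory Num.Theory.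
Import numFieldNormedType.Exports.

Local Open Scope classical_set_scope.
Local Open Scope ring_scope.
Local Open Scope complex_scope.

(** * The Hilbert lattice l2 *)

Section l2_space.
Context (R : realType).
Implicit Types f g : nat -> R.

(** Square summability is phrased with bounded partial sums, so that it needs no limit, and as a
    boolean predicate, so that [l2] inherits its vector space structure as a subtype. *)
Definition sq_summable : {pred (nat -> R)} :=
  [pred f : nat -> R | `[< exists M, forall n, \sum_(i < n) f i ^+ 2 <= M >]].

Lemma sq_summableP f :
  reflect (exists M, forall n, \sum_(i < n) f i ^+ 2 <= M) (f \in sq_summable).
Proof. exact: asboolP. Qed.

Lemma ler_sq_summable f g : (forall i, `|f i| <= `|g i|) ->
  g \in sq_summable -> f \in sq_summable.
Proof.
move=> fg /sq_summableP[M gM]; apply/sq_summableP; exists M => n.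
apply: le_trans (gM n); apply: ler_sum => i _.
by rewrite -real_normK ?num_real// -[leRHS]real_normK ?num_real// lerXn2r ?nnegrE.
Qed.

(** Closure under combinations rests on (a f + g)^2 <= 2 a^2 f^2 + 2 g^2, which is (a f - g)^2 >= 0
    rearranged. *)
Lemma sq_summable_submod : submod_closed sq_summable.
Proof.
split=> [|a f g /sq_summableP[M fM] /sq_summableP[N gN]]; apply/sq_summableP.
  by exists 0 => n; rewrite big1// => i _; rewrite expr0n.
exists (2 * (a ^+ 2 * M) + 2 * N) => n.
apply: (@le_trans _ _ (\sum_(i < n) (2 * (a ^+ 2 * f i ^+ 2) + 2 * g i ^+ 2))).
  apply: ler_sum => i _; rewrite -[leRHS]addr0.
  have -> : (a *: f + g) i = a * f i + g i by [].
  by have := sqr_ge0 (a * f i - g i); lra.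
by rewrite big_split/= -!mulr_sumr lerD ?ler_wpM2l ?sqr_ge0 ?fM ?gN.
Qed.

HB.instance Definition _ :=
  GRing.isSubmodClosed.Build R (nat -> R) sq_summable sq_summable_submod.

Record l2 := L2 { l2_val :> nat -> R ; l2_valP : l2_val \in sq_summable }.

HB.instance Definition _ := [isSub for l2_val].
HB.instance Definition _ := [Choice of l2 by <:].
HB.instance Definition _ := [SubChoice_isSubLmodule of l2 by <:].

End l2_space.
Arguments sq_summable {R}.

(** * Inner product and norm of l2 *)

Section l2_dot.
Context (R : realType).
Local Notation E := (l2 R).
Implicit Types (x y z : E) (f g : nat -> R).

Lemma l2P x y : (forall i, x i = y i) -> x = y.
Proof. by move=> xy; apply/val_inj/funext. Qed.

Lemma l2D x y i : (x + y) i = x i + y i. Proof. by []. Qed.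
Lemma l2N x i : (- x) i = - x i. Proof. by []. Qed.
Lemma l2B x y i : (x - y) i = x i - y i. Proof. by []. Qed.
Lemma l2Z a x i : (a *: x) i = a * x i. Proof. by []. Qed.
Lemma l20 i : (0 : E) i = 0. Proof. by []. Qed.

(** Defined on all sequences: the value is the zero vector when [f] is not square summable, so every
    evaluation requires a proof of summability. *)
Definition l2_of f : E := insubd 0 f.

Lemma l2_ofE f i : f \in sq_summable -> l2_of f i = f i.
Proof.
move=> fP; rewrite /l2_of.
by have -> : l2_val (insubd (0 : E) f) = f by exact: (insubdK _ fP).
Qed.

Definition psum f g n : R := \sum_(i < n) f i * g i.

Definition l2dot x y : R := limn (psum x y).

Lemma psum_homo f : {homo psum f f : n m / (n <= m)%N >-> n <= m}.
Proof.
move=> m n mn; rewrite /psum -!(big_mkord xpredT (fun i => f i * f i)).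
rewrite (big_cat_nat (n := m) (p := n))//= lerDl sumr_ge0// => i _.
by rewrite -expr2 sqr_ge0.
Qed.

Let cvg_psum_sq x : cvgn (psum x x).
Proof.
apply: nondecreasing_is_cvgn; first exact: psum_homo.
have /sq_summableP[M xM] := l2_valP x.
by exists M => _ [n _ <-]; apply: le_trans (xM n).
Qed.

(** Polarization writes the partial sums through those of x + y, x and y with themselves, which are
    monotone and bounded. *)
Lemma cvg_psum x y : psum x y @ \oo --> l2dot x y.
Proof.
suff psumE : psum x y =
    (fun n => 2^-1 * (psum (x + y : E) (x + y : E) n - psum x x n - psum y y n)).
  rewrite /l2dot psumE; apply: cvgP; apply: cvgMl_tmp.
  by apply: cvgB; [apply: cvgB|]; exact: cvg_psum_sq.
apply/funext => n; rewrite /psum.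
rewrite -!sumrB mulr_sumr; apply: eq_bigr => i _; by rewrite l2D; lra.
Qed.

Arguments cvg_psum : clear implicits.

Lemma psum_dot x y l : psum x y @ \oo --> l -> l2dot x y = l.
Proof. by move=> /cvg_lim; apply. Qed.

Lemma l2dotC x y : l2dot x y = l2dot y x.
Proof.
congr (limn _); apply/funext => n.
by rewrite /psum; apply: eq_bigr => i _; rewrite mulrC.
Qed.

Lemma l2dotDl a x y z : l2dot (a *: x + y) z = a * l2dot x z + l2dot y z.
Proof.
apply: psum_dot.
rewrite (_ : psum _ _ = (fun n => a * psum x z n + psum y z n)); last first.
  apply/funext => n; rewrite /psum mulr_sumr -big_split/=; apply: eq_bigr => i _.
  by rewrite mulrDl mulrA.
by apply: cvgD; [apply: cvgMl_tmp|]; exact: cvg_psum.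
Qed.

Lemma l2dot_bilinear : bilinear_for
  (GRing.Scale.Law.clone _ _ ( *%R ) _)
  (GRing.Scale.Law.clone _ _ (@idfun R \; *%R) _) l2dot.
Proof.
split=> [z a x y|z a x y] /=; first exact: l2dotDl.
by rewrite -!(l2dotC _ z) l2dotDl.
Qed.

HB.instance Definition _ := bilinear_isBilinear.Build R E E R
  (GRing.Scale.Law.clone _ _ ( *%R ) _)
  (GRing.Scale.Law.clone _ _ (@idfun R \; *%R) _) l2dot l2dot_bilinear.

Lemma l2dot_herm x y : l2dot x y = (-1) ^+ false * idfun (l2dot y x).
Proof. by rewrite expr0 mul1r l2dotC. Qed.

HB.instance Definition _ :=
  isHermitianSesquilinear.Build R E false (@idfun R) l2dot l2dot_herm.

Lemma psum_sq_le x n : psum x x n <= l2dot x x.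
Proof.
exact: (nondecreasing_cvgn_le (@psum_homo x) (@cvg_psum_sq x)).
Qed.

Lemma sqr_coord_le x i : x i ^+ 2 <= l2dot x x.
Proof.
apply: le_trans (psum_sq_le x i.+1).
rewrite /psum big_ord_recr/= -expr2 lerDr sumr_ge0// => j _.
by rewrite -expr2 sqr_ge0.
Qed.

Lemma l2dot_ge0 x : 0 <= l2dot x x.
Proof. exact: le_trans (sqr_ge0 _) (sqr_coord_le x 0%N). Qed.

Lemma l2dot_eq0 x : l2dot x x = 0 -> x = 0.
Proof.
move=> x0; apply: l2P => i; apply/eqP; rewrite l20 -sqrf_eq0 eq_le sqr_ge0 andbT.
by rewrite -x0 sqr_coord_le.
Qed.

Lemma l2dot_gt0 x : x != 0 -> 0 < l2dot x x.
Proof.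
by move=> x0; rewrite lt0r l2dot_ge0 andbT; apply: contra_neq x0 => /l2dot_eq0.
Qed.

HB.instance Definition _ := isDotProduct.Build R E l2dot l2dot_gt0.

(** For y <> 0, expand the nonnegative square of <y, y> x - <x, y> y and cancel the factor <y,
    y>. *)
Lemma l2_CauchySchwarz x y : l2dot x y ^+ 2 <= l2dot x x * l2dot y y.
Proof.
have [->|/l2dot_gt0 y0] := eqVneq y 0.
  have d0 z : l2dot z 0 = 0 by exact: linear0r.
  by rewrite !d0 expr0n mulr0.
have := l2dot_ge0 (l2dot y y *: x - l2dot x y *: y).
rewrite !(linearBl, linearBr, linearZl_LR, linearZr_LR)/= (l2dotC y x).
rewrite [leRHS](_ : _ = l2dot y y * (l2dot x x * l2dot y y - l2dot x y ^+ 2)).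
  by rewrite pmulr_rge0// subr_ge0.
by ring.
Qed.

Definition l2norm x : R := Num.sqrt (l2dot x x).

Lemma sqr_l2norm x : l2norm x ^+ 2 = l2dot x x.
Proof. by rewrite sqr_sqrtr// l2dot_ge0. Qed.

Lemma l2norm_ge0 x : 0 <= l2norm x. Proof. exact: sqrtr_ge0. Qed.

Lemma ler_l2normD x y : l2norm (x + y) <= l2norm x + l2norm y.
Proof.
rewrite -ler_sqr ?nnegrE ?addr_ge0 ?l2norm_ge0//.
rewrite sqrrD !sqr_l2norm linearDl !linearDr/= (l2dotC y x).
have : l2dot x y <= l2norm x * l2norm y.
  rewrite (le_trans (ler_norm _))// -ler_sqr ?nnegrE ?mulr_ge0 ?l2norm_ge0//.
  by rewrite real_normK ?num_real// exprMn !sqr_l2norm l2_CauchySchwarz.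
by lra.
Qed.

Lemma l2normZ a x : l2norm (a *: x) = `|a| * l2norm x.
Proof.
rewrite /l2norm linearZl_LR linearZr_LR/= mulrA -expr2 sqrtrM ?sqr_ge0//.
by rewrite sqrtr_sqr.
Qed.

Lemma l2norm0_eq0 x : l2norm x = 0 -> x = 0.
Proof. by move=> x0; apply: l2dot_eq0; rewrite -sqr_l2norm x0 expr0n. Qed.

HB.instance Definition _ := Lmodule_isNormed.Build R E
  ler_l2normD l2normZ l2norm0_eq0.

Lemma l2_normE x : `|x| ^+ 2 = l2dot x x. Proof. exact: sqr_l2norm. Qed.

Lemma ler_coord_norm x i : `|x i| <= `|x|.
Proof.
rewrite -ler_sqr ?nnegrE// l2_normE real_normK ?num_real//.
exact: sqr_coord_le.
Qed.

End l2_dot.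
Arguments cvg_psum {R} x y.

(** * Dominated convergence, completeness and the coordinatewise order *)

Section l2_convergence.
Context (R : realType).
Local Notation E := (l2 R).
Implicit Types (x y z d : E).

(** Beyond [N] the squares of [d] are bounded by those of [x]. For N = 0 this is monotonicity of the
    norm; for large [N] it controls tails uniformly in [d]. *)
Lemma l2dot_le_tail d x N : (forall i, `|d i| <= `|x i|) ->
  l2dot d d <= psum d d N + (l2dot x x - psum x x N).
Proof.
move=> dx.
suff dn n : psum d d n <= psum d d N + (l2dot x x - psum x x N).
  by apply: (cvgr_to_le (cvg_psum d d)); apply: nearW.
have [nN|/ltnW Nn] := leqP n N.
  by rewrite -[leLHS]addr0 lerD ?psum_homo// subr_ge0 psum_sq_le.
have split_psum (w : E) : psum w w n = psum w w N + \sum_(N <= i < n) w i ^+ 2.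
  rewrite /psum -!(big_mkord xpredT (fun i => w i * w i)).
  by rewrite (big_cat_nat (n := N) (p := n)).
rewrite split_psum lerD2l lerBrDl; apply: le_trans (psum_sq_le x n).
rewrite split_psum lerD2l; apply: ler_sum => i _.
by rewrite -[leLHS]real_normK ?num_real// -[leRHS]real_normK ?num_real// ler_sqr ?nnegrE.
Qed.

Lemma ler_l2_norm x y : (forall i, `|x i| <= `|y i|) -> `|x| <= `|y|.
Proof.
move=> xy; rewrite -ler_sqr ?nnegrE// !l2_normE.
by have := l2dot_le_tail 0 xy; rewrite /psum !big_ord0 subr0 add0r.
Qed.

Lemma cvg_psum_coord T (F : set_system T) {FF : Filter F} (y : T -> nat -> R)
    (z : nat -> R) N : (forall i, y t i @[t --> F] --> z i) ->
  psum (y t) (y t) N @[t --> F] --> psum z z N.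
Proof.
move=> yz; elim: N => [|N IH].
  rewrite /psum big_ord0 (_ : (fun _ => _) = (fun=> 0)); first exact: cvg_cst.
  by apply/funext => t; rewrite big_ord0.
rewrite /psum big_ord_recr/=.
rewrite (_ : (fun _ => _) = (fun t => psum (y t) (y t) N + y t N * y t N)).
  by apply: cvgD; [exact: IH|apply: cvgM; exact: yz].
by apply/funext => t; rewrite big_ord_recr.
Qed.

(** The square of the error splits into finitely many coordinates, which tend to 0, and a tail
    bounded by that of [x]. *)
Lemma l2_dominated_cvg T (F : set_system T) {FF : Filter F} (y : T -> E) z x :
  (forall i, y t i @[t --> F] --> z i) ->
  (\forall t \near F, forall i, `|y t i - z i| <= `|x i|) ->
  y @ F --> z.
Proof.
move=> yz yx; apply/cvgrPdist_le => e e0.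
have e2 : 0 < e ^+ 2 / 2 by rewrite divr_gt0// exprn_gt0.
have [N _ xN] : \forall n \near \oo, `|l2dot x x - psum x x n| <= e ^+ 2 / 2.
  by move/cvgrPdist_le : (cvg_psum x x); apply.
have {}xN := xN N (leqnn N).
have d0 : psum (fun i => y t i - z i) (fun i => y t i - z i) N @[t --> F] --> (0 : R).
  have -> : (0 : R) = psum (fun=> 0) (fun=> 0) N.
    by rewrite /psum big1// => i _; rewrite mulr0.
  apply: cvg_psum_coord => i; rewrite -(subrr (z i)).
  by apply: cvgB; [exact: yz|exact: cvg_cst].
move/cvgrPdist_le : d0 => /(_ _ e2) d0.
near=> t; rewrite distrC -ler_sqr ?nnegrE ?(ltW e0)// l2_normE.
have dt : forall i, `|(y t - z) i| <= `|x i| by near: t.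
apply: le_trans (l2dot_le_tail N dt) _; rewrite [leRHS]splitr lerD//.
  have : `|0 - psum (fun i => y t i - z i) (fun i => y t i - z i) N| <= e ^+ 2 / 2.
    by near: t.
  by rewrite sub0r normrN; apply: le_trans; rewrite ler_norm.
exact: le_trans (ler_norm _) xN.
Unshelve. all: by end_near. Qed.

Lemma cvg_coord T (F : set_system T) {FF : Filter F} (y : T -> E) z i :
  y @ F --> z -> y t i @[t --> F] --> z i.
Proof.
move=> /cvgrPdist_le yz; apply/cvgrPdist_le => e e0.
move: (yz _ e0); apply: filterS => t; apply: le_trans.
by rewrite -l2B ler_coord_norm.
Qed.

Lemma l2_complete (F : set_system E) : ProperFilter F -> cauchy F -> cvg F.
Proof.
move=> FF /cauchy_ballP Fc.
have coordF i : cvg ((fun x : E => x i) @ F).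
  apply/cauchy_cvgP/cauchy_ballP => e e0.
  have /= [[P Q] [/= FP FQ] PQ] := Fc e e0.
  exists ((fun x : E => x i) @` P, (fun x : E => x i) @` Q).
    by split; [apply: filterS FP|apply: filterS FQ] => f; exists f.
  case=> _ _ [/= [f Pf <-] [g Qg <-]]; have /= := PQ (f, g) (conj Pf Qg).
  by rewrite -!ball_normE /=; apply: le_lt_trans; rewrite -l2B ler_coord_norm.
pose l i : R := lim ((fun x : E => x i) @ F).
(* The Cauchy estimate is passed to the coordinatewise limit on each finite sum; the bound does not
   depend on [N], so it survives in the norm. *)
have close e : 0 < e -> \forall x \near F, forall N,
    psum (fun i => (x : E) i - l i) (fun i => (x : E) i - l i) N <= e ^+ 2.
  move=> e0; have /= [[P Q] [/= FP FQ] PQ] := Fc e e0.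
  apply: filterS FP => x Px N.
  have c : (fun y : E => psum (fun i => x i - y i) (fun i => x i - y i) N) @ F -->
      psum (fun i => x i - l i) (fun i => x i - l i) N.
    apply: (@cvg_psum_coord _ _ _ (fun (y : E) i => x i - y i)) => i.
    by apply: cvgB; [exact: cvg_cst|exact: coordF].
  apply: (cvgr_to_le c); apply: filterS FQ => y Qy.
  apply: le_trans (psum_sq_le (x - y) N) _; rewrite -l2_normE.
  rewrite ler_sqr ?nnegrE ?(ltW e0)//.
  by have /= := PQ (x, y) (conj Px Qy); rewrite -ball_normE /= => /ltW.
(* The limit is a vector [x] minus the difference x - l, whose partial sums of squares are at most
   1. *)
have lP : l \in sq_summable.
  have [x xl] := filter_ex (close 1 ltr01).
  have -> : l = \val x - (\val x - l) by rewrite opprB addrC subrK.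
  apply: rpredB; first exact: l2_valP.
  apply/sq_summableP; exists (1 ^+ 2) => n; apply: le_trans (xl n).
  by rewrite /psum le_eqVlt; apply/orP; left; apply/eqP/eq_bigr => i _; rewrite expr2.
apply/cvg_ex; exists (L2 lP); apply/cvgrPdist_le => e e0.
apply: filterS (close e e0) => x xl.
rewrite distrC -ler_sqr ?nnegrE ?(ltW e0)// l2_normE.
by apply: (cvgr_to_le (cvg_psum _ _)); apply: nearW => n; exact: xl.
Qed.

HB.instance Definition _ := Uniform_isComplete.Build E l2_complete.

Definition l2_vle x y := forall i, x i <= y i.
Definition l2_vsup x y : E := l2_of (fun i => Num.max (x i) (y i)).
Definition l2_vinf x y : E := l2_of (fun i => Num.min (x i) (y i)).

Lemma sq_summable_norm x : (fun i => `|x i|) \in sq_summable.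
Proof. by apply: ler_sq_summable (l2_valP x) => i; rewrite normr_id. Qed.

Lemma sq_summable_le_normD (f : nat -> R) x y :
  (forall i, `|f i| <= `|x i| + `|y i|) -> f \in sq_summable.
Proof.
move=> fxy; have := rpredD (sq_summable_norm x) (sq_summable_norm y).
apply: ler_sq_summable => i; rewrite (le_trans (fxy i))//.
by rewrite [leRHS]ger0_norm// addr_ge0.
Qed.

Lemma l2_vsupE x y i : l2_vsup x y i = Num.max (x i) (y i).
Proof.
rewrite l2_ofE//; apply: (@sq_summable_le_normD _ x y) => j.
by case: (leP (x j) (y j)) => _; rewrite ?lerDl ?lerDr ?normr_ge0.
Qed.

Lemma l2_vinfE x y i : l2_vinf x y i = Num.min (x i) (y i).
Proof.
rewrite l2_ofE//; apply: (@sq_summable_le_normD _ x y) => j.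
by case: (leP (x j) (y j)) => _; rewrite ?lerDl ?lerDr ?normr_ge0.
Qed.

Lemma l2_vle_refl x : l2_vle x x. Proof. by move=> i. Qed.

Lemma l2_vle_anti x y : l2_vle x y -> l2_vle y x -> x = y.
Proof. by move=> xy yx; apply: l2P => i; apply/eqP; rewrite eq_le xy yx. Qed.

Lemma l2_vle_trans x y z : l2_vle x y -> l2_vle y z -> l2_vle x z.
Proof. by move=> xy yz i; apply: le_trans (xy i) (yz i). Qed.

Lemma l2_vleD2r z x y : l2_vle x y -> l2_vle (x + z) (y + z).
Proof. by move=> xy i; rewrite !l2D lerD2r. Qed.

Lemma l2_vle_scale (a : R) x y : 0 <= a -> l2_vle x y -> l2_vle (a *: x) (a *: y).
Proof. by move=> a0 xy i; rewrite !l2Z ler_wpM2l. Qed.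

Lemma l2_vsup_le x y z : l2_vle (l2_vsup x y) z <-> l2_vle x z /\ l2_vle y z.
Proof.
split=> [h|[xz yz] i]; last by rewrite l2_vsupE ge_max xz yz.
by split=> i; have := h i; rewrite l2_vsupE ge_max => /andP[].
Qed.

Lemma l2_vle_inf x y z : l2_vle z (l2_vinf x y) <-> l2_vle z x /\ l2_vle z y.
Proof.
split=> [h|[zx zy] i]; last by rewrite l2_vinfE le_min zx zy.
by split=> i; have := h i; rewrite l2_vinfE le_min => /andP[].
Qed.

HB.instance Definition _ := isVectorLattice.Build R E
  l2_vle_refl l2_vle_anti l2_vle_trans l2_vleD2r l2_vle_scale
  l2_vsup_le l2_vle_inf.

Lemma l2_vle_norm x y : vle (vabs x) (vabs y) -> `|x| <= `|y|.
Proof.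
move=> xy; apply: ler_l2_norm => i; have := xy i.
by rewrite [vabs x i]l2_vsupE [vabs y i]l2_vsupE !l2N !maxrN.
Qed.

HB.instance Definition _ := hasLatticeNorm.Build R E l2_vle_norm.

HB.instance Definition _ := hasInnerProductNorm.Build R E
  (dotp := l2dot (R := R)) (@l2_normE R).

End l2_convergence.

(** * Diagonal semigroups and their generators *)

Lemma linear_fun0 (K : nzRingType) (U U' : lmodType K) (S : U -> U') :
  linear S -> S 0 = 0.
Proof. by move=> Sl; rewrite -{1}(addNr 0) -scaleN1r Sl scaleN1r addNr. Qed.

(** * Real operators acting on the complexification *)

Section complexified_operators.
Context (R : realType) (E : hilbertLatticeType R).
Local Notation H := (complexification E).

Lemma complexification_cvg T (F : set_system T) {FF : Filter F} (f : T -> H)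
    (a : H) :
  ((f t).1 @[t --> F] --> a.1) -> ((f t).2 @[t --> F] --> a.2) -> f @ F --> a.
Proof.
move=> /cvgrPdist_le f1 /cvgrPdist_le f2; apply/cvgrPdist_le => -[e e'].
rewrite ltcE /= => /andP[/eqP -> e0].
have e2 : 0 < e / 2 by rewrite divr_gt0.
near=> t; apply: le_trans (ler_cnorm_add _) _; rewrite lecR [leRHS]splitr.
by rewrite lerD//=; near: t; [apply: f1|apply: f2].
Unshelve. all: by end_near. Qed.

Lemma complexification_cvg_fst T (F : set_system T) {FF : Filter F} (f : T -> H)
  (a : H) : f @ F --> a -> (f t).1 @[t --> F] --> a.1.
Proof.
move=> /cvgrPdist_le fa; apply/cvgrPdist_le => e e0.
have e0C : 0 < e%:C by rewrite ltcR.
apply: filterS (fa _ e0C) => t; rewrite -lecR.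
by apply: le_trans; exact: (ler_norm_fst (a - f t)).
Qed.

Lemma complexification_cvg_snd T (F : set_system T) {FF : Filter F} (f : T -> H)
  (a : H) : f @ F --> a -> (f t).2 @[t --> F] --> a.2.
Proof.
move=> /cvgrPdist_le fa; apply/cvgrPdist_le => e e0.
have e0C : 0 < e%:C by rewrite ltcR.
apply: filterS (fa _ e0C) => t; rewrite -lecR.
by apply: le_trans; exact: (ler_norm_snd (a - f t)).
Qed.

Definition complexify (S : E -> E) (f : H) : H := (S f.1, S f.2).

Lemma complexify_linear (S : E -> E) : linear S -> linear (complexify S).
Proof.
move=> Sl; have S0 := linear_fun0 Sl.
have SZ (a : R) x : S (a *: x) = a *: S x.
  by rewrite -{1}[a *: x]addr0 Sl S0 addr0.
have SD x y : S (x + y) = S x + S y by have := Sl 1 x y; rewrite !scale1r.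
have SN x : S (- x) = - S x by rewrite -scaleN1r SZ scaleN1r.
move=> [a b] [x y] [x' y']; rewrite /complexify /=.
congr pair; rewrite /= !SD ?SN !SZ//.
Qed.

Lemma complexify_continuous (S : E -> E) : continuous S -> continuous (complexify S).
Proof.
move=> Sc f; apply: (@complexification_cvg H (nbhs f) _ (complexify S)).
  apply: (@cvg_comp _ _ _ (fun g : H => g.1) S _ _ _ _ (Sc f.1)).
  exact: (@complexification_cvg_fst H (nbhs f) _ id).
apply: (@cvg_comp _ _ _ (fun g : H => g.2) S _ _ _ _ (Sc f.2)).
exact: (@complexification_cvg_snd H (nbhs f) _ id).
Qed.

End complexified_operators.

Section resolvents.
Context (R : realType) (V : completeNormedModType R[i]).

(* By the resolvent identity [B = (1 - (z - w) B) C], one compact resolvent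
   makes all of them compact. *)
Lemma resolvent_precompact (A : partial_operator V) (z w : R[i]) (B C : V -> V)
    (K : set V) :
  is_resolvent A w C -> is_resolvent A z B -> compact K ->
  C @` [set x | `|x| <= 1] `<=` K -> precompact (B @` [set x | `|x| <= 1]).
Proof.
move=> Cr Br Kc CK.
pose g v := v - (z - w) *: B v.
have gc : continuous g.
  move=> v; apply: cvgB; first exact: cvg_id.
  by apply: cvgZl_tmp; exact: (res_bounded Br).
have BE y : B y = g (C y).
  have Blin := res_linear Br.
  have e1 : y + (z - w) *: C y = z *: C y - pop_val A (C y).
    by rewrite -{1}(res_right Cr y) scalerBl [LHS]addrC addrA subrK.
  have := res_left Br (res_dom Cr y); rewrite -e1 addrC Blin => e2.
  by apply/eqP; rewrite eq_sym subr_eq addrC e2.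
apply: (@precompact_subset _ _ (g @` K)).
  by move=> _ [y y1 <-]; exists (C y); rewrite ?BE//; apply: CK; exists y.
apply: compact_precompact; first exact: norm_hausdorff.
by apply: continuous_compact => //; exact: continuous_subspaceT.
Qed.

End resolvents.

(** * Multiplication operators and Hilbert cubes *)

Section multiplication.
Context (R : realType).
Local Notation E := (l2 R).
Implicit Types (a : nat -> R) (x y : E).

Definition mulop a x : E := l2_of (fun i => a i * x i).

Lemma mulopE a x i : (forall i, `|a i| <= 1) -> mulop a x i = a i * x i.
Proof.
move=> a1; rewrite l2_ofE//; apply: ler_sq_summable (l2_valP x) => j.
by rewrite normrM ler_piMl.
Qed.

Lemma mulop_linear a : (forall i, `|a i| <= 1) -> linear (mulop a).
Proof.
by move=> a1 c x y; apply: l2P => i; rewrite !(l2D, l2Z, mulopE)//; ring.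
Qed.

Lemma mulop_dot a x y : (forall i, `|a i| <= 1) ->
  l2dot (mulop a x) y = l2dot x (mulop a y).
Proof.
move=> a1; congr (limn _); apply/funext => n; apply: eq_bigr => i _.
by rewrite !mulopE//; ring.
Qed.

Lemma ler_norm_mulop a x : (forall i, `|a i| <= 1) -> `|mulop a x| <= `|x|.
Proof. by move=> a1; apply: ler_l2_norm => i; rewrite mulopE// normrM ler_piMl. Qed.

Lemma nonexpansive_continuous (S : E -> E) :
  linear S -> (forall x, `|S x| <= `|x|) -> continuous S.
Proof.
move=> Sl S1 x; apply/(@cvgrPdist_le _ _ _ (nbhs x)) => e e0.
have SB y z : S (y - z) = S y - S z.
  by rewrite addrC -scaleN1r Sl scaleN1r addrC.
have := nbhsx_ballx x _ e0; apply: filterS => y; rewrite -ball_normE /= => xy.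
by rewrite -SB; exact: le_trans (S1 _) (ltW xy).
Qed.

(** Along an ultrafilter on the cube each coordinate converges in its compact segment, and dominated
    convergence upgrades this to norm convergence. *)
Lemma Hilbert_cube_compact (c : E) : compact [set x : E | forall i, `|x i| <= `|c i|].
Proof.
rewrite compact_ultra => F FF Fc; have PF : ProperFilter F := @ultra_proper _ F FF.
have coordF i : exists l : R, `|l| <= `|c i| /\ (fun x : E => x i) @ F --> l.
  have := @segment_compact R (- `|c i|) `|c i|; rewrite compact_ultra.
  have UF : UltraFilter ((fun x : E => x i) @ F).
    split; [exact: fmap_proper_filter|move=> G PG FG]; rewrite predeqE => A.
    split=> [GA|]; last exact: FG.
    have := @in_ultra_setVsetC _ F ((fun x : E => x i) @^-1` A) FF.
    case=> // FnA; exfalso.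
    have GnA : G (~` A) by apply: FG.
    by have /filter_ex[? []] : G (A `&` ~` A) by apply: filterI.
  have FI : F ((fun x : E => x i) @^-1` `[- `|c i|, `|c i|]).
    apply: filterS Fc => x /(_ i) xc.
    by rewrite /preimage/= in_itv/= -ler_norml.
  move=> /(_ _ UF FI)[l []].
  by rewrite /= in_itv/= -ler_norml => lc Fl; exists l.
have [l lP] := choice coordF.
have lE : l \in sq_summable.
  by apply: ler_sq_summable (l2_valP c) => i; have [] := lP i.
exists (L2 lE); split; first by move=> i; have [] := lP i.
(* Both the point and its limit lie in the cube, so their difference is bounded by twice [c]. *)
apply: (@l2_dominated_cvg R E F _ id (L2 lE) (2 *: c)).
  by move=> i; have [] := lP i.
apply: filterS Fc => x xc i; apply: le_trans (ler_normB _ _) _.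
rewrite l2Z normrM ger0_norm// mulr_natl mulr2n lerD//.
by have [] := lP i.
Qed.

End multiplication.

(** * Derivative at 0 of the scalar exponentials *)

Section exponential_quotient.
Context (R : realType).

(** With a = h c, the bounds come from 1 - a <= exp(-a) <= 1 / (1 + a) <= 1 - a + a^2. *)
Lemma expR_quotient_bounds (c h : R) : 0 <= c -> 0 < h ->
  - c <= h^-1 * (expR (- (`|h| * c)) - 1) <= - c + h * c ^+ 2.
Proof.
move=> c0 h0; rewrite gtr0_norm//.
have e1 := expR_ge1Dx (- (h * c)); have e2 := expR_ge1Dx (h * c).
have hc : 0 <= h * c by rewrite mulr_ge0// ltW.
rewrite mulrC ler_pdivlMr// ler_pdivrMr//; apply/andP; split; first by lra.
have : expR (- (h * c)) * (1 + h * c) <= 1.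
  rewrite expRN mulrC ler_pdivrMr ?mul1r ?expR_gt0//.
set y := expR _ in e1 *.
have y0 : 0 <= y by exact: expR_ge0.
set a := h * c in hc e1 *.
have -> : (- c + h * c ^+ 2) * h = - a + a ^+ 2 by rewrite /a; ring.
by nra.
Qed.

Lemma cvg_expR_quotient (c : R) : 0 <= c ->
  h^-1 * (expR (- (`|h| * c)) - 1) @[h --> 0^'+] --> - c.
Proof.
move=> c0; apply: (@squeeze_cvgr _ _ _ _ (cst (- c)) (fun h => - c + h * c ^+ 2)).
- by near=> h; apply: expR_quotient_bounds.
- exact: cvg_cst.
rewrite -[X in _ --> X]addr0 -[X in _ --> _ + X](mul0r (c ^+ 2)).
apply: cvgD; first exact: cvg_cst.
apply: cvgMr_tmp; apply: cvg_within_filter; exact: cvg_id.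
Unshelve. all: by end_near. Qed.

End exponential_quotient.

(** * Semigroups unitarily equivalent to a diagonal one *)

Section diagonal_semigroup.
Context (R : realType).
Local Notation E := (l2 R).
Local Notation H := (complexification E).
Variables (m : nat -> R) (V W : {linear E -> E}).
(** [V] and [W] are inverse and adjoint to each other, hence unitary. The condition [m_HS] makes the
    resolvent at 1 Hilbert-Schmidt and gives its compactness. *)
Hypotheses (m_ge0 : forall i, 0 <= m i)
  (m_HS : (fun i => (1 + m i)^-1) \in sq_summable)
  (VK : cancel V W) (WK : cancel W V)
  (adjVW : forall x y, l2dot (W x) y = l2dot x (V y)).

Lemma isometry_V x : `|V x| = `|x|.
Proof.
apply/eqP; rewrite -(@eqrXn2 _ 2)// !l2_normE.
by rewrite -adjVW VK.
Qed.

Lemma isometry_W x : `|W x| = `|x|.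
Proof. by rewrite -{2}[x]WK isometry_V. Qed.

Lemma V_continuous : continuous V.
Proof. by apply: nonexpansive_continuous => [|x]; [exact: linearP|rewrite isometry_V]. Qed.

Lemma W_continuous : continuous W.
Proof. by apply: nonexpansive_continuous => [|x]; [exact: linearP|rewrite isometry_W]. Qed.

Definition decay (t : R) i := expR (- (`|t| * m i)).
Definition resolv i := (1 + m i)^-1.

Lemma decay_le1 t i : `|decay t i| <= 1.
Proof.
by rewrite ger0_norm ?expR_ge0// -expR0 ler_expR oppr_le0 mulr_ge0.
Qed.
Hint Resolve decay_le1 : core.

Lemma resolv_le1 i : `|resolv i| <= 1.
Proof.
have m1 : 1 <= 1 + m i by rewrite lerDl.
by rewrite ger0_norm ?invr_ge0 ?invf_le1 ?(le_trans ler01)// (lt_le_trans ltr01).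
Qed.
Hint Resolve resolv_le1 : core.

(* [| t |] is an arbitrary extension to negative times that keeps the
   operators bounded. *)
Definition dsg (t : R) : E -> E := W \o mulop (decay t) \o V.
Definition dres : E -> E := W \o mulop resolv \o V.

Lemma conj_mulop_linear a : (forall i, `|a i| <= 1) ->
  linear (W \o mulop a \o V).
Proof. by move=> a1 c x y; rewrite /= linearP mulop_linear// linearP. Qed.

Lemma conj_mulop_continuous a : (forall i, `|a i| <= 1) ->
  continuous (W \o mulop a \o V).
Proof.
move=> a1; apply: nonexpansive_continuous; first exact: conj_mulop_linear.
by move=> x; rewrite /= isometry_W -[leRHS]isometry_V ler_norm_mulop.
Qed.

Lemma dsg_adjoint t x y : l2dot (dsg t x) y = l2dot x (dsg t y).
Proof.
by rewrite /dsg /= adjVW mulop_dot// [in RHS]l2dotC adjVW l2dotC.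
Qed.

Lemma dsg_continuous_time x : continuous (fun t => dsg t x).
Proof.
move=> t; apply: (@cvg_comp _ _ _ (fun t => mulop (decay t) (V x)) W _ _ _ _
  (@W_continuous (mulop (decay t) (V x)))).
apply: (@l2_dominated_cvg R R (nbhs t) _ _ _ (2 *: V x)) => [i|].
  rewrite mulopE//; under eq_fun do rewrite mulopE//.
  apply: cvgMr_tmp; apply: (@cvg_comp _ _ _ (fun s => - (`|s| * m i)) expR
    _ _ _ _ (@continuous_expR R (- (`|t| * m i)))).
  apply: cvgN; apply: cvgMr_tmp; exact: norm_continuous.
apply: nearW => s i; rewrite !mulopE// -mulrBl l2Z !normrM ler_wpM2r//.
by rewrite [leRHS]ger0_norm// (le_trans (ler_normB _ _))// -[2]/(1 + 1) lerD.
Qed.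

Definition csg (t : R) : H -> H := complexify (dsg t).
Definition cres : H -> H := complexify dres.

Lemma csg_C0_semigroup : C0_semigroup csg.
Proof.
split.
- by move=> t _; apply: complexify_linear; exact: conj_mulop_linear.
- by move=> t _; apply: complexify_continuous; exact: conj_mulop_continuous.
- move=> [x y]; rewrite /csg /complexify /dsg /=.
  have D0 z : mulop (decay 0) z = z.
    by apply: l2P => i; rewrite mulopE// /decay normr0 mul0r oppr0 expR0 mul1r.
  by rewrite !D0 !VK.
- move=> s t [x y] s0 t0; rewrite /csg /complexify /dsg /= !WK.
  have DD z : mulop (decay (s + t)) z = mulop (decay s) (mulop (decay t) z).
    apply: l2P => i; rewrite !mulopE// mulrA /decay -expRD !ger0_norm ?addr_ge0//.
    by congr (expR _ * _); ring.
  by rewrite !DD.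
- move=> [x y]; apply: continuous_subspaceT => t.
  apply: (@complexification_cvg R E R (nbhs t) _ _ (csg t (x, y))).
    exact: dsg_continuous_time.
  exact: dsg_continuous_time.
Qed.

Lemma csg_real : real_semigroup csg.
Proof.
move=> t _ _ [[x y] /= y0 <-]; rewrite /real_part /= in y0 *; rewrite y0.
exact: linear_fun0 (conj_mulop_linear (decay_le1 t)).
Qed.

Lemma csg_self_adjoint : self_adjoint_semigroup csg.
Proof.
move=> t _ [a b] [c d]; rewrite /cdot /=.
have dE x y : dotp (dsg t x) y = dotp x (dsg t y) := dsg_adjoint t x y.
by rewrite !dE.
Qed.

Let V_sub x y i : V (x - y) i = V x i - V y i.
Proof. by rewrite linearB. Qed.

Let V_scale a x i : V (a *: x) i = a * V x i.
Proof. by have -> : V (a *: x) = a *: V x by exact: linearZ_LR. Qed.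

Let quotient (f : H) (h : R) : H := (h^-1)%:C *: (csg h f - f).

Let quotientE f h :
  quotient f h = (h^-1 *: (dsg h f.1 - f.1), h^-1 *: (dsg h f.2 - f.2)).
Proof.
rewrite /quotient; congr pair; rewrite /= scale0r ?subr0 ?addr0//.
Qed.

Let V_quotient x h i :
  V (h^-1 *: (dsg h x - x)) i = h^-1 * (expR (- (`|h| * m i)) - 1) * V x i.
Proof.
by rewrite V_scale V_sub WK mulopE// /decay; ring.
Qed.

(** Norm convergence forces convergence of the coordinates after [V], so on its domain the generator
    can only be multiplication by -m. *)
Let V_limit x a :
  h^-1 *: (dsg h x - x) @[h --> 0^'+] --> a -> forall i, V a i = - m i * V x i.
Proof.
move=> xa i.
have Vxa : V (h^-1 *: (dsg h x - x)) @[h --> 0^'+] --> V a.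
  exact: (@cvg_comp _ _ _ _ V _ _ _ xa (@V_continuous a)).
have Vxai : V (h^-1 *: (dsg h x - x)) i @[h --> 0^'+] --> V a i.
  exact: cvg_coord Vxa.
have Vxmi : V (h^-1 *: (dsg h x - x)) i @[h --> 0^'+] --> - m i * V x i.
  under eq_fun do rewrite V_quotient.
  by apply: cvgMr_tmp; exact: cvg_expR_quotient.
exact: (cvg_unique (@norm_hausdorff _ _) Vxai Vxmi).
Qed.

Let V_dres x i : V (dres x) i = (1 + m i)^-1 * V x i.
Proof. by rewrite WK mulopE. Qed.

Let m1_neq0 i : 1 + m i != 0.
Proof. by rewrite gt_eqF// (lt_le_trans ltr01)// lerDl. Qed.

(** The range of [dres] lies in the domain, and there A (1 - A)^-1 = (1 - A)^-1 - 1. The limit is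
    taken by dominated convergence with bound [V x]. *)
Let cvg_dres x :
  h^-1 *: (dsg h (dres x) - dres x) @[h --> 0^'+] --> dres x - x.
Proof.
have -> : dres x - x = W (V (dres x - x)) by rewrite VK.
have -> : (fun h => h^-1 *: (dsg h (dres x) - dres x)) =
    W \o (fun h => V (h^-1 *: (dsg h (dres x) - dres x))).
  by apply/funext => h /=; rewrite VK.
apply: (@cvg_comp _ _ _ _ W _ _ _ _ (@W_continuous _)).
apply: (@l2_dominated_cvg R R (0^'+) _ _ _ (V x)) => [i|].
  under eq_fun do rewrite V_quotient.
  rewrite V_sub V_dres.
  have -> : (1 + m i)^-1 * V x i - V x i = - m i * ((1 + m i)^-1 * V x i).
    by field.
  by apply: cvgMr_tmp; exact: cvg_expR_quotient.
near=> h => i; rewrite V_quotient V_sub V_dres.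
have h0 : 0 < h by [].
have /andP[q1 q2] : - m i <= h^-1 * (expR (- (`|h| * m i)) - 1) <= 0.
  have /andP[-> _] := expR_quotient_bounds (m_ge0 i) h0.
  rewrite pmulr_rle0 ?invr_gt0// subr_le0 -expR0 ler_expR oppr_le0.
  by rewrite mulr_ge0.
set q := h^-1 * _ in q1 q2 *.
(* The factor (q + m) / (1 + m) lies in [0, 1] because -m <= q <= 0. *)
have -> : q * ((1 + m i)^-1 * V x i) - ((1 + m i)^-1 * V x i - V x i) =
    (q + m i) * (1 + m i)^-1 * V x i by field.
rewrite normrM ler_piMl// normrM [`|(1 + _)^-1|]ger0_norm; last first.
  by rewrite invr_ge0 addr_ge0.
rewrite ler_pdivrMr ?mul1r ?(lt_le_trans ltr01) ?lerDl//.
by rewrite ger0_norm; have := m_ge0 i; lra.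
Unshelve. all: by end_near. Qed.

Lemma csg_resolvent : is_resolvent (generator csg) 1 cres.
Proof.
have cvg_cres f : quotient (cres f) h @[h --> 0^'+] --> cres f - f.
  apply: (@complexification_cvg R E R (0^'+)).
    by under eq_fun do rewrite quotientE; exact: cvg_dres.
  by under eq_fun do rewrite quotientE; exact: cvg_dres.
have genE f : pop_val (generator csg) (cres f) = cres f - f.
  by apply: cvg_lim; [exact: norm_hausdorff|exact: cvg_cres].
split.
- by apply: complexify_linear; exact: conj_mulop_linear.
- by apply: complexify_continuous; exact: conj_mulop_continuous.
- by move=> f; apply: (cvgP _ (cvg_cres f)).
- by move=> f; rewrite genE scale1r opprB addrC subrK.
- move=> f; rewrite /generator /= -/(quotient f) => fd.
  set a := lim _ in fd *.
  (* By [V_limit], [V] takes x - b to the coordinates (1 + m i) (V x i), and [dres] divides by 1 + m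
     i. *)
  have dresK x b : h^-1 *: (dsg h x - x) @[h --> 0^'+] --> b -> dres (x - b) = x.
    move=> /V_limit xb; apply: (can_inj VK); apply: l2P => i.
    by rewrite V_dres V_sub xb; field.
  rewrite scale1r; case: f a fd => x y [b c] fd; congr pair; apply: dresK.
    have : (quotient (x, y) h).1 @[h --> 0^'+] --> b.
      exact: complexification_cvg_fst fd.
    by under eq_fun do rewrite quotientE.
  have : (quotient (x, y) h).2 @[h --> 0^'+] --> c.
    exact: complexification_cvg_snd fd.
  by under eq_fun do rewrite quotientE.
Qed.

(** The resolvent at 1 maps the unit ball into the image under [W] of a product of two Hilbert
    cubes; [resolvent_precompact] transfers this to every other resolvent. *)
Lemma csg_compact_resolvent : compact_resolvent (generator csg).
Proof.
split; first by exists 1, cres; exact: csg_resolvent.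
move=> z B Br; split; first exact: (res_linear Br).
pose cube := [set x : E | forall i, `|x i| <= `|l2_of resolv i|].
have cubec : compact cube := @Hilbert_cube_compact R (l2_of resolv).
(* The cubes are compact in the product topology of E * E; [g] also carries them over to the norm
   topology of the complexification. *)
pose g (p : E * E) : H := (W p.1, W p.2).
have gc : continuous g.
  move=> p; apply: (@complexification_cvg R E (E * E)%type (nbhs p) _ g).
    exact: (@cvg_comp _ _ _ fst W _ _ _ cvg_fst (@W_continuous p.1)).
  exact: (@cvg_comp _ _ _ snd W _ _ _ cvg_snd (@W_continuous p.2)).
apply: (@resolvent_precompact R H (generator csg) z 1 B cres (g @` (cube `*` cube))
  csg_resolvent Br).
  apply: continuous_compact; first exact: continuous_subspaceT.
  exact: compact_setX.
have inC x : `|x| <= 1 -> cube (mulop resolv (V x)).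
  move=> x1 i; rewrite mulopE// l2_ofE// normrM ler_piMr//.
  by rewrite (le_trans (ler_coord_norm _ _))// isometry_V.
move=> _ [[x y] /= xy1 <-]; exists (mulop resolv (V x), mulop resolv (V y)) => //.
have x1 := le_trans (ler_norm_fst _) xy1; have y1 := le_trans (ler_norm_snd _) xy1.
rewrite !lecR in x1 y1.
by split; apply: inC.
Qed.

End diagonal_semigroup.

(** * Pairs of coordinates *)

Section pairs.
Context (R : realType).
Local Notation E := (l2 R).
Implicit Types (f g : E) (x y : nat -> R).

(* The coordinates [2k] and [2k+1] form the [k]-th pair. *)
Definition partner i := if odd i then i.-1 else i.+1.

Lemma odd_partner i : odd (partner i) = ~~ odd i.
Proof.
rewrite /partner; case: (boolP (odd i)) => [|/negPf /= ->//].
by case: i => //= n /negPf ->.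
Qed.

Lemma partnerK : involutive partner.
Proof.
by move=> i; rewrite {1}/partner odd_partner /partner; case: i => // n /=; case: odd.
Qed.

Lemma half_partner i : (partner i)./2 = i./2.
Proof.
rewrite /partner; case: ifPn => i_odd.
  by case: i i_odd => //= n /negPf on; rewrite uphalf_half on.
by rewrite /= uphalf_half (negPf i_odd).
Qed.

Lemma partner_even k : partner k.*2 = k.*2.+1.
Proof. by rewrite /partner odd_double. Qed.

Lemma partner_odd k : partner k.*2.+1 = k.*2.
Proof. by rewrite /partner /= odd_double. Qed.

(** The length is even so that no pair is cut in two. *)
Lemma psum_pair_partner x y n :
  psum (x \o partner) y n.*2 = psum x (y \o partner) n.*2.
Proof.
rewrite /psum; elim: n => [|n IH]; first by rewrite !big_ord0.
rewrite doubleS !big_ord_recr/= IH -!addrA; congr (_ + _).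
by rewrite partner_even partner_odd addrC.
Qed.

Lemma sq_summable_pairs x :
  (exists M, forall n, psum x x n.*2 <= M) -> x \in sq_summable.
Proof.
move=> [M xM]; apply/sq_summableP; exists M => n; apply: le_trans (xM n).
have -> : \sum_(i < n) x i ^+ 2 = psum x x n.
  by apply: eq_bigr => i _; rewrite expr2.
by apply: psum_homo; rewrite -addnn leq_addr.
Qed.

Lemma sq_summable_partner f : f \o partner \in sq_summable.
Proof.
apply: sq_summable_pairs; exists (l2dot f f) => n.
rewrite psum_pair_partner.
have -> : ((f \o partner) \o partner) = f by apply/funext => i /=; rewrite partnerK.
exact: psum_sq_le.
Qed.

Definition swap f : E := l2_of (f \o partner).

Lemma swapE f i : swap f i = f (partner i).
Proof. by rewrite l2_ofE// sq_summable_partner. Qed.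

Lemma cvg_psum_pairs f g : psum f g n.*2 @[n --> \oo] --> l2dot f g.
Proof.
apply: (@cvg_comp _ _ _ double (psum f g) _ _ _ _ (cvg_psum f g)).
by move=> A [N _ NA]; exists N => // n /= Nn; apply: NA; rewrite /= (leq_trans Nn)// -addnn leq_addr.
Qed.

Lemma swap_dot f g : l2dot (swap f) g = l2dot f (swap g).
Proof.
have swap_fun w : l2_val (swap w) = w \o partner.
  by apply/funext => i; rewrite swapE.
have swap_psum n : psum (swap f) g n.*2 = psum f (swap g) n.*2.
  by rewrite !swap_fun psum_pair_partner.
have fg := @cvg_psum_pairs (swap f) g.
have gf : psum (swap f) g n.*2 @[n --> \oo] --> l2dot f (swap g).
  by under eq_fun do rewrite swap_psum; exact: cvg_psum_pairs.
exact: (cvg_unique (@norm_hausdorff _ _) fg gf).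
Qed.

Definition sgn i : R := (-1) ^+ odd i.

Lemma sgn_le1 i : `|sgn i| <= 1. Proof. by rewrite normrX normrN1 expr1n. Qed.
Hint Resolve sgn_le1 : core.

(** On each pair this is the symmetric orthogonal matrix with rows (1, 1) and (1, -1) over sqrt 2:
    the even coordinate receives the symmetric component, the odd one the antisymmetric
    component. *)
Definition pair_rot f : E := (Num.sqrt 2)^-1 *: (swap f + mulop sgn f).

Lemma pair_rotE f i : pair_rot f i = (Num.sqrt 2)^-1 * (f (partner i) + sgn i * f i).
Proof. by rewrite l2Z l2D swapE mulopE. Qed.

Lemma pair_rot_linear : linear pair_rot.
Proof. by move=> a f g; apply: l2P => i; rewrite !(pair_rotE, l2D, l2Z); ring. Qed.

HB.instance Definition _ := GRing.isLinear.Build R E E *:%R pair_rot pair_rot_linear.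

Lemma sqr_invsqrt2 : (Num.sqrt 2)^-1 * (Num.sqrt 2)^-1 = 2^-1 :> R.
Proof. by rewrite -invfM -expr2 sqr_sqrtr. Qed.

Lemma pair_rotK : involutive pair_rot.
Proof.
move=> f; apply: l2P => i; rewrite !pair_rotE partnerK /sgn odd_partner.
rewrite mulrCA -mulrDr mulrA sqr_invsqrt2; case: odd => /=; rewrite ?expr1 ?expr0; lra.
Qed.

Lemma pair_rot_dot f g : l2dot (pair_rot f) g = l2dot f (pair_rot g).
Proof.
have dotDr (x : E) : l2dot f (swap g + x) = l2dot f (swap g) + l2dot f x.
  exact: linearDr.
by rewrite /pair_rot linearZl_LR linearZr_LR/= dotDr linearDl/= swap_dot mulop_dot.
Qed.

(** The reflection in the hyperplane orthogonal to [h]; for h = 0 it is the identity. *)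
Definition householder (h : E) f : E := f - (2 / l2dot h h * l2dot f h) *: h.

Lemma householderE h f i : householder h f i = f i - 2 / l2dot h h * l2dot f h * h i.
Proof. by []. Qed.

Lemma householder_linear h : linear (householder h).
Proof.
by move=> a f g; apply: l2P => i; rewrite !(householderE, l2D, l2Z) linearPl/=; ring.
Qed.

HB.instance Definition _ h :=
  GRing.isLinear.Build R E E *:%R (householder h) (householder_linear h).

Lemma householderK h : involutive (householder h).
Proof.
have [->|h0] := eqVneq h 0.
  by move=> f; rewrite /householder !scaler0 !subr0.
move=> f; apply: l2P => i; rewrite !householderE.
have -> a : l2dot (f - a *: h) h = l2dot f h - a * l2dot h h.
  by rewrite linearBl linearZl_LR.
by field; rewrite gt_eqF// l2dot_gt0.
Qed.

Lemma householder_dot h f g : l2dot (householder h f) g = l2dot f (householder h g).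
Proof.
rewrite /householder linearBl linearBr linearZl_LR linearZr_LR/= (l2dotC h g); ring.
Qed.

End pairs.
Arguments sgn {R}.
Arguments pair_rot {R} f : simpl never.
Arguments householder {R} h f : simpl never.

(** * Comparing inner products with partial sums *)

Section l2_sums.
Context (R : realType).
Local Notation E := (l2 R).
Implicit Types (f g : E).

Lemma psum_le_l2dot f g n : (forall i, (n <= i)%N -> 0 <= f i * g i) ->
  psum f g n <= l2dot f g.
Proof.
move=> fg; apply: (cvgr_to_ge (cvg_psum f g)); exists n => // p /= np.
rewrite /psum -!(big_mkord xpredT (fun i => f i * g i)).
rewrite (big_cat_nat (n := n) (p := p))//= lerDl big_nat sumr_ge0// => i.
by move=> /andP[/fg].
Qed.

Lemma l2dot_le_psum f g n : (forall i, (n <= i)%N -> f i * g i <= 0) ->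
  l2dot f g <= psum f g n.
Proof.
have dotN : l2dot (- f) g = - l2dot f g by exact: linearNl.
move=> fg; have := @psum_le_l2dot (- f) g n; rewrite dotN.
have -> : psum (- f : E) g n = - psum f g n.
  by rewrite /psum -sumrN; apply: eq_bigr => i _; rewrite l2N mulNr.
by rewrite lerN2; apply => i /fg; rewrite l2N mulNr oppr_ge0.
Qed.

Definition unit_vector k : E := l2_of (fun i => (i == k)%:R).

Lemma unit_vectorE k i : unit_vector k i = (i == k)%:R.
Proof.
rewrite l2_ofE//; apply/sq_summableP; exists 1 => n.
have [kn|nk] := ltnP k n.
  rewrite (bigD1 (Ordinal kn))//= eqxx big1 ?expr1n ?addr0// => j.
  by rewrite -val_eqE/= => /negPf ->; rewrite expr0n.
rewrite big1// => j _; rewrite (_ : (j == k :> nat) = false) ?expr0n//.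
by apply/negbTE; rewrite neq_ltn (leq_trans (ltn_ord j)).
Qed.

Lemma l2dot_unit_vector k f : l2dot (unit_vector k) f = f k.
Proof.
have e_psum : psum (unit_vector k) f k.+1 = f k.
  rewrite /psum big_ord_recr/= unit_vectorE eqxx mul1r big1 ?add0r// => j _.
  by rewrite unit_vectorE ltn_eqF ?mul0r.
have e0 i : (k.+1 <= i)%N -> unit_vector k i * f i = 0.
  by move=> ki; rewrite unit_vectorE gtn_eqF// mul0r.
apply/eqP; rewrite -e_psum eq_le l2dot_le_psum ?psum_le_l2dot// => i /e0 ->//.
Qed.

End l2_sums.

(** * The counterexample *)

Section counterexample.
Context (R : realType).
Local Notation E := (l2 R).
Local Notation H := (complexification E).
Implicit Types (f g : E) (t : R).

(** * Eigenvalues and the weight vector *)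

Definition eps k : R := expR (- (5 * k%:R * 2 ^+ k)).

(** These are the negated eigenvalues in the basis of [pair_rot]: even indices belong to symmetric
    vectors, odd ones to antisymmetric vectors. The rate 0 at index 0 keeps the symmetric part of
    the first pair from decaying. *)
Definition rate i : R :=
  if i == 0%N then 0 else 2 ^+ i./2 + (~~ odd i)%:R * eps i./2.

Lemma eps_gt0 k : 0 < eps k. Proof. exact: expR_gt0. Qed.

Lemma expR_le_inv (x : R) : 0 <= x -> expR (- x) <= (1 + x)^-1.
Proof.
move=> x0; rewrite expRN lef_pV2 ?posrE ?expR_gt0 ?expR_ge1Dx//.
by rewrite ltr_wpDr.
Qed.

Lemma eps0 : eps 0 = 1. Proof. by rewrite /eps mulr0 mul0r oppr0 expR0. Qed.

Lemma pow2_ge1 k : 1 <= 2 ^+ k :> R.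
Proof. by rewrite exprn_ege1// ler1n. Qed.

Lemma pow2_ge2 k : (0 < k)%N -> 2 <= 2 ^+ k :> R.
Proof. by case: k => // k _; rewrite exprS; have := pow2_ge1 k; lra. Qed.

(** With p = 2^k, exp(-5 k p) <= 1 / (1 + 5 k p) <= 1 / (5 p), and 2/25 <= 1/8. *)
Lemma eps_sq_bound k : (0 < k)%N -> 2 * eps k ^+ 2 <= 8^-1 * (2 ^+ k)^-1.
Proof.
move=> k0; have k1 : 1 <= k%:R :> R by rewrite ler1n.
have p1 := pow2_ge1 k; set p : R := 2 ^+ k in p1 *.
have pV0 : 0 <= p^-1 by rewrite invr_ge0; lra.
have pV1 : p^-1 <= 1 by rewrite invf_le1; lra.
have e5 : eps k <= 5^-1 * p^-1.
  apply: le_trans (expR_le_inv _) _; first by rewrite -/p; nra.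
  rewrite -invfM lef_pV2 ?posrE -/p; nra.
have e0 := eps_gt0 k.
have : eps k ^+ 2 <= (5^-1 * p^-1) ^+ 2 by rewrite ler_sqr ?nnegrE; nra.
rewrite exprMn => h; have : p^-1 ^+ 2 <= p^-1 by nra.
by lra.
Qed.

Lemma eps_le1 k : eps k <= 1.
Proof. by rewrite -expR0 ler_expR oppr_le0 !mulr_ge0 ?exprn_ge0. Qed.

Lemma psum_half (a : nat -> R) n :
  psum (fun i => a i./2) (fun i => a i./2) n.*2 = \sum_(k < n) 2 * a k ^+ 2.
Proof.
rewrite /psum; elim: n => [|n IH]; first by rewrite !big_ord0.
rewrite doubleS !big_ord_recr/= IH -addrA uphalf_double doubleK; congr (_ + _).
by ring.
Qed.

(** The term k = 0 gives 2 and the geometric bounds for k >= 1 add up to 1/8. Subtracting the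
    remaining geometric tail makes the induction close. *)
Lemma sum_eps_bound n : \sum_(k < n) 2 * eps k ^+ 2 <= 17 / 8.
Proof.
suff : \sum_(k < n) 2 * eps k ^+ 2 <= 17 / 8 - 4^-1 * (2 ^+ n)^-1.
  by have : 0 <= (2 ^+ n)^-1 :> R by []; lra.
elim: n => [|n IH]; first by rewrite big_ord0 expr0; lra.
rewrite big_ord_recr/= (exprS 2 n) invfM.
have [n0|n0] := posnP n.
  by rewrite n0 big_ord0 eps0 expr0; lra.
by have := eps_sq_bound n0; lra.
Qed.

Lemma sq_summable_eps : (fun i => eps i./2) \in sq_summable.
Proof.
by apply: sq_summable_pairs; exists (17 / 8) => n; rewrite psum_half sum_eps_bound.
Qed.

Definition wt : E := l2_of (fun i => eps i./2).

Lemma wtE i : wt i = eps i./2. Proof. by rewrite l2_ofE// sq_summable_eps. Qed.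

Lemma wt_gt0 i : 0 < wt i. Proof. by rewrite wtE eps_gt0. Qed.
Hint Resolve wt_gt0 : core.

Lemma wt_partner i : wt (partner i) = wt i.
Proof. by rewrite !wtE half_partner. Qed.

Lemma wt01 i : (i < 2)%N -> wt i = 1.
Proof. by case: i => [|[|//]] _; rewrite wtE/= eps0. Qed.

Lemma l2dot_wt_ge : 2 <= l2dot wt wt.
Proof.
apply: le_trans (psum_sq_le wt 2); rewrite /psum !big_ord_recr big_ord0/=.
by rewrite !wt01//; lra.
Qed.

Lemma l2dot_wt_le : l2dot wt wt <= 17 / 8.
Proof.
apply: (cvgr_to_le (@cvg_psum_pairs R wt wt)); apply: nearW => n.
have -> : l2_val wt = (fun i => eps i./2) by apply/funext => i; rewrite wtE.
by rewrite psum_half sum_eps_bound.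
Qed.

Lemma rate_ge i : (0 < i)%N -> 2 ^+ i./2 <= rate i.
Proof. by rewrite /rate; case: i => //= i _; rewrite lerDl mulr_ge0// ltW// eps_gt0. Qed.

Lemma rate_ge1 i : (0 < i)%N -> 1 <= rate i.
Proof. by move=> /rate_ge; apply: le_trans; exact: pow2_ge1. Qed.

Lemma rate_ge0 i : 0 <= rate i.
Proof. by case: i => // i; apply: le_trans (rate_ge1 _). Qed.
Hint Resolve rate_ge0 : core.

Lemma rate_HS : (fun i => (1 + rate i)^-1) \in sq_summable.
Proof.
have S : (fun i => ((2 : R) ^+ i./2)^-1) \in sq_summable.
  apply: sq_summable_pairs; exists 4 => n; rewrite (psum_half (fun k => (2 ^+ k)^-1)).
  suff : \sum_(k < n) 2 * ((2 ^+ k)^-1 : R) ^+ 2 <= 4 - 4 * (2 ^+ n)^-1.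
    by have : 0 <= (2 ^+ n)^-1 :> R by []; lra.
  elim: n => [|n IH]; first by rewrite big_ord0 expr0; lra.
  rewrite big_ord_recr/= (exprS 2 n) invfM.
  have := pow2_ge1 n; set p : R := 2 ^+ n in IH * => p1.
  have pV0 : 0 <= p^-1 by rewrite invr_ge0; lra.
  have pV1 : p^-1 <= 1 by rewrite invf_le1; lra.
  by nra.
apply: ler_sq_summable S => i.
have r0 := rate_ge0 i; have p1 := pow2_ge1 i./2.
rewrite !ger0_norm ?invr_ge0 ?addr_ge0// ?lef_pV2 ?posrE//; [|by lra..].
case: i r0 p1 => [|i] r0 p1; first by rewrite /= expr0; lra.
by have := @rate_ge i.+1 isT; lra.
Qed.

(** * The reflected semigroup and its matrix entries *)

Definition sgV : {linear E -> E} := pair_rot \o householder wt.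
Definition sgW : {linear E -> E} := householder wt \o pair_rot.

Lemma sgVK : cancel sgV sgW.
Proof. by move=> f; rewrite /sgV /sgW /= pair_rotK householderK. Qed.

Lemma sgWK : cancel sgW sgV.
Proof. by move=> f; rewrite /sgV /sgW /= householderK pair_rotK. Qed.

Lemma sg_adj f g : l2dot (sgW f) g = l2dot f (sgV g).
Proof. by rewrite /sgV /sgW /= householder_dot pair_rot_dot. Qed.

Definition sg : R -> E -> E := dsg rate sgV sgW.

Definition pair_sg t f : E := pair_rot (mulop (decay rate t) (pair_rot f)).

(** Indexed by a coordinate but constant on its pair: halving and doubling selects the even index,
    where the symmetric eigenvalue sits. *)
Definition sym_decay t i := decay rate t i./2.*2.
Definition anti_decay t i := decay rate t i./2.*2.+1.

Lemma decayE t i : decay rate t i = if odd i then anti_decay t i else sym_decay t i.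
Proof.
rewrite /sym_decay /anti_decay; have := odd_double_half i.
by case: (odd i) => /= half_i; rewrite -{1}half_i.
Qed.

(** The 2 by 2 block has half the sum of the two decay factors on the diagonal and half their
    difference off it; that difference is the only source of negativity before the reflection. *)
Lemma pair_sgE t f i :
  pair_sg t f i = 2^-1 * ((sym_decay t i + anti_decay t i) * f i +
    (sym_decay t i - anti_decay t i) * f (partner i)).
Proof.
have d1 := decay_le1 rate_ge0 t; have ss := sqr_invsqrt2 R.
rewrite /pair_sg pair_rotE !mulopE// !pair_rotE partnerK !decayE odd_partner.
rewrite [sym_decay t (partner i)]/sym_decay.
rewrite [anti_decay t (partner i)]/anti_decay half_partner.
rewrite -/(sym_decay t i) -/(anti_decay t i).
rewrite /sgn odd_partner -ss; set s := (Num.sqrt 2)^-1.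
by case: (odd i) => /=; rewrite ?expr1 ?expr0; ring.
Qed.

Definition decayed_wt t : E := pair_sg t wt.

(** The weight is equal on both coordinates of a pair, so it has no antisymmetric component. *)
Lemma decayed_wtE t i : decayed_wt t i = sym_decay t i * wt i.
Proof. by rewrite /decayed_wt pair_sgE wt_partner; lra. Qed.

Lemma pair_sg_dot t f g : l2dot (pair_sg t f) g = l2dot f (pair_sg t g).
Proof.
by rewrite /pair_sg pair_rot_dot mulop_dot ?pair_rot_dot//; exact: decay_le1.
Qed.

Definition hh_coef : R := 2 / l2dot wt wt.

(** The squared norm of the weight lies between 2, its first pair, and 17/8. A coefficient this
    close to 1 leaves a positive margin in [coef_bounds]. *)
Lemma hh_coef_bounds : 16 / 17 <= hh_coef <= 1.
Proof.
have N0 := l2dot_wt_ge; have N1 := l2dot_wt_le.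
by rewrite /hh_coef ler_pdivlMr ?ler_pdivrMr; lra.
Qed.

(** Both reflections are expanded, and self-adjointness of [pair_sg] moves it onto the weight, where
    it acts by the symmetric factor alone. *)
Lemma sgE t f i : sg t f i =
  pair_sg t f i - hh_coef * l2dot f wt * (sym_decay t i * wt i) -
  hh_coef * (l2dot f (decayed_wt t) -
    hh_coef * l2dot f wt * l2dot wt (decayed_wt t)) * wt i.
Proof.
have -> : sg t f = householder wt (pair_sg t (householder wt f)) by [].
rewrite householderE.
rewrite pair_sg_dot -/(decayed_wt t) -/hh_coef; congr (_ - hh_coef * _ * _).
  by rewrite !pair_sgE !householderE wt_partner -/hh_coef; field.
by rewrite /householder linearBl linearZl_LR.
Qed.

(** * Decay factors and their pairings with the weight *)

Lemma sym_decay_first t i : (i < 2)%N -> sym_decay t i = 1.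
Proof.
move=> i2; have -> : sym_decay t i = decay rate t 0 by case: i i2 => [|[|]].
by rewrite /decay /rate eqxx mulr0 oppr0 expR0.
Qed.

Lemma sym_decay_ge0 t i : 0 <= sym_decay t i. Proof. exact: expR_ge0. Qed.

Lemma sym_decay_le1 t i : sym_decay t i <= 1.
Proof. by apply: le_trans (ler_norm _) _; exact: decay_le1. Qed.

Lemma decay_le t i : 0 <= t -> (0 < i)%N -> decay rate t i <= expR (- t).
Proof.
move=> t0 /rate_ge1 r1; rewrite /decay ger0_norm// ler_expR lerN2.
by rewrite ler_peMr.
Qed.

Lemma sym_decay_le t i : 0 <= t -> (2 <= i)%N -> sym_decay t i <= expR (- t).
Proof. by move=> t0 i2; apply: decay_le => //; rewrite double_gt0 half_gt0. Qed.

Lemma anti_decay_bounds t i : 0 <= t -> 0 <= anti_decay t i <= expR (- t).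
Proof. by move=> t0; rewrite decay_le// andbT expR_ge0. Qed.

Lemma pair_decayE t i : 0 <= t -> (2 <= i)%N ->
  anti_decay t i = expR (- (t * 2 ^+ i./2)) /\
  sym_decay t i = anti_decay t i * expR (- (t * wt i)).
Proof.
move=> t0 i2.
have QE : anti_decay t i = expR (- (t * 2 ^+ i./2)).
  by rewrite /anti_decay /decay /rate/= odd_double/= uphalf_double mul0r addr0 ger0_norm.
split=> //; rewrite QE -expRD /sym_decay /decay /rate odd_double double_eq0 doubleK.
rewrite wtE ger0_norm// ifN -?lt0n ?half_gt0//; congr expR; rewrite mul1r; ring.
Qed.

Lemma psum2 x y : psum x y 2 = x 0%N * y 0%N + x 1%N * y 1%N :> R.
Proof. by rewrite /psum !big_ord_recr big_ord0/= add0r. Qed.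

(** The first pair alone contributes 2, since its symmetric part does not decay. *)
Lemma wt_decayed_wt_ge t : 2 <= l2dot wt (decayed_wt t).
Proof.
have := @psum_le_l2dot R wt (decayed_wt t) 2.
rewrite psum2 !decayed_wtE !wt01// !sym_decay_first// !mulr1.
move=> le_dot; apply: le_trans (le_dot _) => [|i _]; first by lra.
by rewrite decayed_wtE !mulr_ge0 ?sym_decay_ge0// ltW.
Qed.

Lemma wt_decayed_wt_le t : l2dot wt (decayed_wt t) <= l2dot wt wt.
Proof.
rewrite -subr_ge0; have <- : l2dot wt (wt - decayed_wt t) =
    l2dot wt wt - l2dot wt (decayed_wt t).
  exact: linearBr.
apply: le_trans (@psum_le_l2dot R _ _ 0 _); first by rewrite /psum big_ord0.
move=> i _; rewrite l2B decayed_wtE -{2}[wt i]mul1r -mulrBl !mulr_ge0 ?subr_ge0 ?sym_decay_le1//.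
all: exact: ltW.
Qed.

Lemma l2dot_wt_ge_first f : (forall i, 0 <= f i) -> f 0%N + f 1%N <= l2dot f wt.
Proof.
move=> f0; have := @psum_le_l2dot R f wt 2; rewrite psum2 !wt01// !mulr1.
by apply=> i _; rewrite mulr_ge0// ltW.
Qed.

(** The decayed weight is 1 on the first pair and at most exp(-t) times the weight on all others. *)
Lemma l2dot_decayed_wt_le t f : 0 <= t -> (forall i, 0 <= f i) ->
  l2dot f (decayed_wt t) <=
  f 0%N + f 1%N + expR (- t) * (l2dot f wt - (f 0%N + f 1%N)).
Proof.
move=> t0 f0; have := @l2dot_le_psum R f (decayed_wt t - expR (- t) *: wt) 2.
have -> : l2dot f (decayed_wt t - expR (- t) *: wt) =
    l2dot f (decayed_wt t) - expR (- t) * l2dot f wt.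
  have -> (x y : E) : l2dot f (x - y) = l2dot f x - l2dot f y by exact: linearBr.
  by congr (_ - _); exact: linearZr_LR.
have yE i : (decayed_wt t - expR (- t) *: wt) i = (sym_decay t i - expR (- t)) * wt i.
  by rewrite mulrBl -decayed_wtE.
rewrite psum2 !yE !wt01// !sym_decay_first// => le_psum.
suff le0 : forall i, (2 <= i)%N -> f i * (decayed_wt t - expR (- t) *: wt) i <= 0.
  by have := le_psum le0; lra.
move=> i i2; rewrite yE mulr_ge0_le0// mulr_le0_ge0 ?(ltW (wt_gt0 i))//.
by rewrite subr_le0 sym_decay_le.
Qed.

(** * Positivity for large times depending on the vector *)

Lemma expR_decay t : 9 <= t -> expR (- t) <= 10^-1 /\ t * t * expR (- t) <= 4.
Proof.
move=> t9; split.
  apply: le_trans (expR_le_inv _) _; first lra.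
  by rewrite lef_pV2 ?posrE; lra.
have h := expR_ge1Dx (t / 2).
have -> : expR (- t) = (expR (t / 2) ^+ 2)^-1.
  by rewrite -expRM_natl -expRN; congr expR; lra.
have e0 := expR_gt0 (t / 2); rewrite ler_pdivrMr ?exprn_gt0//.
set x := expR _ in h e0 *; nra.
Qed.

(** Here [k] stands for [hh_coef] and [r] for exp(-t). The expressions are the coefficients left
    over when the two bounds below are collected in [B] and [Y]. *)
Lemma coef_bounds (k r : R) : 16 / 17 <= k -> k <= 1 -> 0 <= r -> r <= 10^-1 ->
  0 <= 2^-1 * (1 - r) - 2 * k + 2 * k * k - 4^-1 /\
  0 <= 2 * k * k - k - k * r - 2^-1.
Proof.
move=> k0 k1 r0 r1; split; first by have := sqr_ge0 (1 - k); lra.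
have x0 : 0 <= k - 16 / 17 by lra.
(* The number 782/1000 is 32/17 - 1 - 1/10 rounded down. *)
have y0 : 0 <= 2 * k - 1 - r - 782 / 1000 by lra.
by have := mulr_ge0 x0 y0; lra.
Qed.

(** For a nonnegative vector [f], [B] is its mass on the first pair, B + Y is its pairing with the
    weight, [b] its pairing with the decayed weight, and [d] the pairing of the two weights; [q] is
    the antisymmetric factor. *)
Lemma first_pair_bound (k r B Y b d q x y : R) :
  16 / 17 <= k -> k <= 1 -> 0 <= r -> r <= 10^-1 -> 0 <= Y -> 0 <= q -> q <= r ->
  0 <= x -> 0 <= y -> x + y = B -> b <= B + r * Y -> 2 <= d ->
  (B + Y) / 4 <= 2^-1 * ((1 + q) * x + (1 - q) * y) - k * (B + Y) -
    k * (b - k * (B + Y) * d).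
Proof.
move=> k0 k1 r0 r1 Y0 q0 qr x0 y0 xyB bB d2.
have kp : 0 <= k by lra.
have B0 : 0 <= B by lra.
have kb : k * b <= k * (B + r * Y) by rewrite ler_wpM2l.
have kd : k * k * (B + Y) * 2 <= k * k * (B + Y) * d.
  by rewrite ler_wpM2l// !mulr_ge0// addr_ge0.
have qy : q * y <= r * y by rewrite ler_wpM2r.
have qx : 0 <= q * x by rewrite mulr_ge0.
have rx : 0 <= r * x by rewrite mulr_ge0.
have [e1 e2] := coef_bounds k0 k1 r0 r1.
have := mulr_ge0 B0 e1; have := mulr_ge0 Y0 e2; rewrite -xyB in kb kd *.
by lra.
Qed.

(** The entry has been divided by the weight; [p] is the symmetric factor, and [z] bounds the
    negative contribution of the partner coordinate. *)
Lemma other_pair_bound (k r B Y b d p z : R) :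
  16 / 17 <= k -> k <= 1 -> 0 <= r -> r <= 10^-1 -> 0 <= B -> 0 <= Y -> p <= r ->
  b <= B + r * Y -> 2 <= d -> z <= (B + Y) / 2 ->
  (B + Y) / 4 <= - (2^-1 * z) - k * (B + Y) * p - k * (b - k * (B + Y) * d).
Proof.
move=> k0 k1 r0 r1 B0 Y0 pr bB d2 zBY.
have kp : 0 <= k by lra.
have kb : k * b <= k * (B + r * Y) by rewrite ler_wpM2l.
have kd : k * k * (B + Y) * 2 <= k * k * (B + Y) * d.
  by rewrite ler_wpM2l// !mulr_ge0// addr_ge0.
have kpr : k * (B + Y) * p <= k * (B + Y) * r by rewrite ler_wpM2l// mulr_ge0// addr_ge0.
have [_ e2] := coef_bounds k0 k1 r0 r1.
have r1' : 0 <= 1 - r by lra.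
have := mulr_ge0 (mulr_ge0 kp r1') Y0.
have := mulr_ge0 B0 e2; have := mulr_ge0 Y0 e2.
by lra.
Qed.

(* On a pair other than the first, the only negative contribution is
   [(anti_decay - sym_decay) / 2] times the partner coordinate; that factor is
   at most [t exp(-t)] times the weight because the two rates differ by exactly
   the weight. *)
Lemma sg_lower t f : 9 <= t -> (forall i, 0 <= f i) -> 0 < l2dot f wt ->
  8 * `|f| <= t * l2dot f wt -> forall i, l2dot f wt / 4 * wt i <= sg t f i.
Proof.
move=> t9 f0 a0 ta i; have t0 : 0 <= t by lra.
rewrite sgE pair_sgE.
have [r1 r2] := expR_decay t9.
have bB := l2dot_decayed_wt_le t0 f0; have aB := l2dot_wt_ge_first f0.
have d2 := wt_decayed_wt_ge t; have /andP[c0 c1] := hh_coef_bounds.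
have r0 : 0 <= expR (- t) by exact: expR_ge0.
have B0 : 0 <= f 0%N + f 1%N by rewrite addr_ge0.
have Y0 : 0 <= l2dot f wt - (f 0%N + f 1%N) by rewrite subr_ge0.
have aE : l2dot f wt = f 0%N + f 1%N + (l2dot f wt - (f 0%N + f 1%N)) by lra.
have x0 := f0 i; have y0 := f0 (partner i).
have /andP[q0 q1] := anti_decay_bounds i t0.
have [i2|i2] := ltnP i 2.
  have piB : f i + f (partner i) = f 0%N + f 1%N.
    by case: (i) i2 => [|[|]]//= _; rewrite addrC.
  rewrite sym_decay_first// wt01// !mulr1 aE.
  exact: (first_pair_bound c0 c1 r0 r1 Y0 q0 q1 x0 y0 piB bB d2).
have [_ PE] := pair_decayE t0 i2.
have pr := sym_decay_le t0 i2; have p0 := sym_decay_ge0 t i; have w0 := wt_gt0 i.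
have yF : f (partner i) <= `|f|.
  by apply: le_trans (ler_coord_norm f (partner i)); exact: ler_norm.
(* Now [p] and [q] are the symmetric and antisymmetric factors, [r] is exp(-t), [e] the weight, [y]
   the partner coordinate, [x] the coordinate itself and [F] the norm. *)
move: (sym_decay t i) (anti_decay t i) (expR (- t)) (wt i) (f (partner i)) (f i)
  `|f| PE pr p0 w0 yF q0 q1 r0 r1 r2 bB x0 y0 ta => p q r e y x F PE pr p0 e0 yF q0 q1 r0 r1 r2 bB x0 y0 ta.
have te : 0 <= t * e by rewrite mulr_ge0// ltW.
have qp : q - p <= r * (t * e).
  apply: (@le_trans _ _ (q * (t * e))); last by rewrite ler_wpM2r.
  rewrite PE -[X in X - _]mulr1 -mulrBr ler_wpM2l//.
  by have := expR_ge1Dx (- (t * e)); lra.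
have qpy : (q - p) * y <= r * (t * e) * F.
  apply: (@le_trans _ _ (r * (t * e) * y)); first by rewrite ler_wpM2r.
  by rewrite ler_wpM2l// mulr_ge0.
have px : 0 <= (p + q) * x by rewrite mulr_ge0// addr_ge0.
(* The choice of [t] gives 8 r t F <= r t^2 <f, w>, and r t^2 <= 4. *)
have rtF : r * t * F <= l2dot f wt / 2.
  have : r * t * (8 * F) <= r * t * (t * l2dot f wt) by rewrite ler_wpM2l// mulr_ge0.
  have : t * t * r * l2dot f wt <= 4 * l2dot f wt by rewrite ler_wpM2r// ltW.
  by lra.
rewrite aE in rtF.
have := other_pair_bound c0 c1 r0 r1 B0 Y0 pr bB d2 rtF; rewrite -aE.
move: (l2dot f wt) (l2dot f (decayed_wt t)) (l2dot wt (decayed_wt t)) (hh_coef) => a b d k.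
move=> /(ler_wpM2r (ltW e0)); lra.
Qed.

(** With [e] the weight on the pair, the off-diagonal entry is at most -q e / 4, whereas the
    reflection adds at most 2 e^2; the inequality 8 e < q decides. *)
Lemma sg_negative n : (0 < n)%N -> sg n%:R (unit_vector R n.*2) n.*2.+1 < 0.
Proof.
move=> n0; rewrite sgE pair_sgE !l2dot_unit_vector decayed_wtE.
rewrite partner_odd !unit_vectorE eqxx gtn_eqF//.
rewrite (_ : false%:R = 0 :> R)// (_ : true%:R = 1 :> R)//.
have hE : wt n.*2 = wt n.*2.+1 by rewrite !wtE/= uphalf_double doubleK.
have PP : sym_decay n%:R n.*2 = sym_decay n%:R n.*2.+1.
  by rewrite /sym_decay/= uphalf_double doubleK.
have nn : 0 <= n%:R :> R by exact: ler0n.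
have n2 : (2 <= n.*2.+1)%N by rewrite ltnS double_gt0.
have [QE PE] := pair_decayE nn n2; have p1 := pow2_ge2 n0.
have n1 : 1 <= n%:R :> R by rewrite ler1n.
rewrite hE PP; set p := sym_decay _ _ in PE *; set q := anti_decay _ _ in QE PE *.
set e := wt _ in PE *.
have e0 : 0 < e by exact: wt_gt0.
have e1 : e <= 1 by rewrite /e wtE eps_le1.
have q0 : 0 < q by exact: expR_gt0.
have p0 : 0 <= p by exact: sym_decay_ge0.
(* The constant 5 in [eps] leaves e / q = exp(-4 n 2^n), which is at most 1/9 because n 2^n >= 2. *)
have eq8 : 8 * e < q.
  have -> : e = q * expR (- (4 * (n%:R * 2 ^+ n))).
    rewrite /e wtE QE -expRD /eps/= uphalf_double; congr expR; ring.
  set z := expR _; have : z <= 9^-1.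
    have np : 2 <= n%:R * 2 ^+ n :> R by apply: le_trans p1 _; rewrite ler_peMl//; lra.
    apply: le_trans (expR_le_inv _) _; first by lra.
    by rewrite lef_pV2 ?posrE; lra.
  move=> z9; have : q * z <= q * 9^-1 by rewrite ler_wpM2l// ltW.
  by lra.
(* Since n >= 1 and e <= 1, 1 - exp(-n e) >= 1 - 1 / (1 + e) >= e / 2. *)
have qp : q * (e / 2) <= q - p.
  rewrite PE -[X in X - _]mulr1 -mulrBr ler_wpM2l ?(ltW q0)//.
  have : expR (- (n%:R * e)) <= expR (- e) by rewrite ler_expR lerN2 ler_peMl// ltW.
  have := expR_le_inv (ltW e0).
  have : (1 + e)^-1 <= 1 - e / 2.
    rewrite -[leLHS]mul1r ler_pdivrMr; last by lra.
    by have := mulr_ge0 (ltW e0) (_ : 0 <= 1 - e); lra.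
  by lra.
have cd : hh_coef * l2dot wt (decayed_wt n%:R) <= 2.
  rewrite /hh_coef -mulrA -[leRHS]mulr1 ler_wpM2l// mulrC ler_pdivrMr ?mul1r ?wt_decayed_wt_le//.
  exact: lt_le_trans l2dot_wt_ge.
have := hh_coef_bounds; move: cd; move: (hh_coef) (l2dot wt _) => k d kd /andP[k0 k1].
have kp : 0 <= k by lra.
have e2 : 0 <= e * e by rewrite mulr_ge0// ltW.
have kkd : k * (k * d) <= 2.
  by have : k * (k * d) <= k * 2 by [rewrite ler_wpM2l]; lra.
have kkde : k * (k * d) * (e * e) <= 2 * (e * e) by rewrite ler_wpM2r.
have kpe : 0 <= k * p * (e * e) by rewrite mulr_ge0// mulr_ge0.
have qe : 8 * e * e < q * e by rewrite ltr_pM2r.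
by lra.
Qed.

End counterexample.

(** * Strict positivity of the weight and the resulting example *)

Lemma wt_dot_gt0 (R : realType) (f : l2 R) : vle 0 f -> f <> 0 ->
  0 < l2dot f (wt R).
Proof.
move=> f0 /eqP fn0; have [i fi] : exists i, f i != 0.
  apply: contrapT => /forallNP fi; case/eqP: fn0; apply: l2P => i; rewrite l20.
  by apply/eqP/negPn/negP; exact: fi.
have fwt0 j : 0 <= f j * wt R j by rewrite mulr_ge0 ?(f0 j)// ltW// wt_gt0.
apply: lt_le_trans (@psum_le_l2dot R f (wt R) i.+1 _) => [|j _]; last exact: fwt0.
rewrite /psum big_ord_recr/= ltr_wpDl ?sumr_ge0// mulr_gt0 ?wt_gt0//.
by rewrite lt0r fi (f0 i).
Qed.

Theorem theorem1p1 (R : realType) :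
  exists (E : hilbertLatticeType R)
         (T : R -> complexification E -> complexification E)
         (u : complexification E),
    (C0_semigroup T /\ real_semigroup T /\ self_adjoint_semigroup T) /\
    strictly_positive u /\
    compact_resolvent (generator T) /\
    individually_eventually_strongly_positive T u /\
    (exists N : nat, forall n : nat, (N <= n)%N ->
       ~ positive_operator (T n%:R)) /\
    (~ uniformly_eventually_positive T /\
     ~ uniformly_eventually_positive_wrt T u u).
Proof.
pose T : R -> complexification (l2 R) -> complexification (l2 R) :=
  csg (@rate R) (sgV R) (sgW R).
pose u : complexification (l2 R) := (wt R, 0).
(* Positive test vectors: at time n >= 1 the image of the n-th one has a negative coordinate at 2n +
   1. *)
pose e n : complexification (l2 R) := (unit_vector R n.*2, 0).
have e_ge0 n : cle 0 (e n).
  by split=> // i; rewrite [leRHS]unit_vectorE l20.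
have not_pos n : (0 < n)%N -> ~ cle 0 (T n%:R (e n)).
  move=> n0 [/(_ n.*2.+1)]; rewrite l20 => /le_lt_trans/(_ (sg_negative R n0)).
  by rewrite ltxx.
have archi (t : R) : exists n, (0 < n)%N /\ t <= n%:R.
  exists (Num.bound `|t|).+1; split => //; apply: le_trans (ler_norm _) _.
  by apply: le_trans (ltW (archi_boundP (normr_ge0 _))) _; rewrite ler_nat.
exists (l2 R), T, u; split; first split; [|split|].
- apply: csg_C0_semigroup; [exact: rate_ge0|exact: sgVK|exact: sgWK|exact: sg_adj].
- by apply: csg_real; exact: rate_ge0.
- apply: csg_self_adjoint; [exact: rate_ge0|exact: sg_adj].
split.
  split; first by split=> // i; rewrite l20 ltW// wt_gt0.
  move=> [f1 f2] [[/= f0 f20] fn0]; rewrite /cdot /= -f20.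
  rewrite !(linear0l, linear0r) addr0 subr0 ltcR.
  rewrite [ltRHS](l2dotC (wt R) f1).
  by apply: wt_dot_gt0 => // f10; apply: fn0; rewrite f10 -f20.
split.
  apply: csg_compact_resolvent; [exact: rate_ge0|exact: rate_HS|exact: sgVK
    |exact: sgWK|exact: sg_adj].
split.
  move=> [f1 f2] [[/= f0 f20] fn0].
  have a0 : 0 < l2dot f1 (wt R).
    by apply: wt_dot_gt0 => // f10; apply: fn0; rewrite f10 -f20.
  (* The summand 9 serves the exponential estimates; the quotient ensures 8 |f1| <= t <f1, w>. *)
  exists (9 + 8 * `|f1| / l2dot f1 (wt R)) => [|t tf].
    by rewrite addr_ge0// divr_ge0 ?mulr_ge0// ltW.
  have r0 : 0 <= 8 * `|f1| / l2dot f1 (wt R) by rewrite divr_ge0 ?mulr_ge0// ltW.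
  exists (l2dot f1 (wt R) / 4); first by rewrite divr_gt0.
  split.
    move=> i /=; rewrite scale0r subr0.
    apply: sg_lower => //; first by lra.
    by rewrite -ler_pdivrMr//; lra.
  rewrite /= scaler0 scale0r addr0 -f20.
  have S0 : dsg (@rate R) (sgV R) (sgW R) t 0 = 0.
    apply: linear_fun0; apply: conj_mulop_linear => i.
    by apply: decay_le1; exact: rate_ge0.
  exact: esym S0.
split; first by exists 1%N => n n0 Tpos; apply: (not_pos n n0); exact: Tpos.
split=> [[t0 _ Tpos]|[t0 [c [_ c0 Tpos]]]]; have [n [n0 tn]] := archi t0.
  by apply: (not_pos n n0); exact: Tpos.
(* The rank-one term sends [e n] to a nonnegative multiple of the weight, so dominating it would
   make the image of [e n] positive. *)
have tu1 : (c%:C *: tensor u u (e n)).1 =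
    (c * l2dot (unit_vector R n.*2) (wt R)) *: wt R.
  rewrite /= scaler0 subr0 scale0r subr0 scalerA; congr (c * _ *: _).
  by rewrite linear0l addr0.
have tu2 : (c%:C *: tensor u u (e n)).2 = 0.
  by rewrite /= !(linear0l, linear0r, subr0, scale0r, scaler0, addr0).
have [ge0 im0] := Tpos _ tn _ (e_ge0 n); rewrite /= in ge0 im0.
apply: (not_pos n n0); split=> [i|].
  have ge0i : 0 <= (T n%:R (e n)).1 i - (c%:C *: tensor u u (e n)).1 i := ge0 i.
  rewrite tu1 l2Z l2dot_unit_vector subr_ge0 in ge0i; apply: le_trans ge0i.
  by rewrite !mulr_ge0 ?ltW// ?wt_gt0.
have : 0 = (T n%:R (e n)).2 - (c%:C *: tensor u u (e n)).2 := im0.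
by rewrite tu2 subr0.
Qed.
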